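(* Let $\phi:X\to C$ be a generalized Raynaud surface over a pre-Tango curve $C$, as constructed in the context, and let $\mathcal Z:=\mathcal O_X(\tilde E)\otimes\phi^*\big(\phi_*(\mathcal O_X(\tilde E)|_{\tilde E})\big)$. Then $$\mathcal Z=\mathcal O_X(\tilde E)\otimes\phi^*\mathcal N^{e/\ell}=\mathcal O_X(\tilde D),\qquad \tilde D=\psi^{-1}(E)+\phi^{-1}D',\quad D'=\tfrac1\ell D.$$
   Context: Construction of the generalized Raynaud surface. Let $k$ be an algebraically closed field of characteristic $p>0$ and $C$ a smooth projective curve over $k$ of genus $g\ge 2$ with function field $K(C)$. A pre-Tango structure on $C$ is an invertible sheaf $\mathcal L=\mathcal O_C(D)$, with $D$ an ample divisor (i.e. $\deg D>0$), such that $(df)\ge pD$ for some $f\in K(C)\setminus K(C)^p$; $C$ is a pre-Tango curve if it has such a structure. Fix such $\mathcal L=\mathcal O_C(D)$ and $f_0\in K(C)\setminus K(C)^p$ with $(df_0)\ge pD$. Fix an integer $e\ge 2$ prime to $p$ with $e\mid\deg\mathcal L$, and an ample invertible sheaf $\mathcal N$ on $C$ with $\mathcal L=\mathcal N^{e}$. Fix an integer $\ell\ge 2$ with $\ell\mid p+1$ and $\ell\mid e$, and put $\mathcal N_\ell:=\mathcal N^{e/\ell}$ (so $\mathcal N_\ell^{\ell}=\mathcal L$). The symbol $\frac1\ell D$ denotes a divisor class $D'$ with $\mathcal O_C(D')=\mathcal N^{e/\ell}$ (so $\ell D'\sim D$). Let $F$ be the Frobenius morphism of $C$ and $\mathcal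 B^1$ the image of $F_*d:F_*\mathcal O_C\to F_*\Omega^1_C$, so $0\to\mathcal O_C\to F_*\mathcal O_C\to\mathcal B^1\to0$ is exact. Then $H^0(C,\mathcal B^1\otimes\mathcal L^{-1})=\{df: (df)\ge pD\}$, and the connecting map $\eta:H^0(C,\mathcal B^1\otimes\mathcal L^{-1})\to H^1(C,\mathcal L^{-1})$ is injective with image the kernel of $F^*:H^1(C,\mathcal L^{-1})\to H^1(C,\mathcal L^{-p})$. The class $\eta(df_0)\neq0$ defines a non-split extension $0\to\mathcal O_C\to\mathcal E\to\mathcal L\to0$ with $\mathcal E$ locally free of rank 2, while $0\to\mathcal O_C\to F^*\mathcal E\to\mathcal L^{p}\to0$ splits (uniquely). Let $\pi:P=\mathbb P(\mathcal E)=\mathrm{Proj}\,S(\mathcal E)\to C$ ($\pi_*\mathcal O_P(1)=\mathcal E$), and let $E\subset P$ be the section of $\pi$ which is the zero divisor of the section $s\in H^0(P,\mathcal O_P(1))=H^0(C,\mathcal E)$ that is the image of $1\in H^0(C,\mathcal O_C)$; so $\mathcal O_P(E)\cong\mathcal O_P(1)$. The splitting gives an exact sequence $0\to\mathcal O_C\to F^*\mathcal E\otimes\mathcal L^{-p}\to\mathcal L^{-p}\to 0$; the image of $1$ in $H^0(C,F^*\mathcal E\otimes\mathcal L^{-p})$ defines a section curve $\Gamma'$ of $P'=\mathbb P(F^*\mathcal E\otimes \mathcal L^{-p})\cong\mathbb P(F^*\mathcal E)\to C$. Let $C''\subset P$ be the preimage of $\Gamma'$ under the relative Frobenius $P\to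 P'$ over $C$ ($p$-th power on the fibre coordinates). Then $\mathcal O_P(C'')\cong\mathcal O_P(p)\otimes\pi^*\mathcal L^{-p}$ and $E\cap C''=\emptyset$. Put $\mathcal M:=\mathcal O_P\big(-\tfrac{p+1}{\ell}\big)\otimes\pi^*\mathcal N_\ell^{\,p}$, so $\mathcal M^{-\ell}=\mathcal O_P(E+C'')$. Let $\psi:X:=\mathcal{S}pec\big(\bigoplus_{i=0}^{\ell-1}\mathcal M^i\big)\to P$ be the cyclic cover of degree $\ell$ ramified at $E+C''$, the algebra structure being tensor product followed, when $i+j\ge\ell$, by multiplication with the section of $\mathcal M^{-\ell}$ defining $E+C''$. Put $\phi=\pi\circ\psi:X\to C$ and $\tilde E=\psi^{-1}(E)$ (the reduced preimage), so $\ell\tilde E=\psi^*E$ and $\tilde E$ is a section of $\phi$. *)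

(* Defs.v *)
(* All schemes below are integral and separated.  Such a scheme S is encoded,
   following Chevalley, as the set of its local rings, each of them a subring of
   the function field F of S; a point of S *is* its local ring (R : set F).
   - x lies in the closure of y iff O_x is contained in O_y.
   - A dominant morphism S -> S' is a field embedding emb : F' -> F such that
     every local ring of S dominates one (necessarily unique) of S'.
   - An invertible sheaf is, up to isomorphism, a subsheaf of the constant sheaf
     F; it is encoded by its stalks, i.e. by a function set F -> set F taking
     each point R to an R-submodule of F.  Only values at points of S matter.
     Tensor products become products of submodules, and an isomorphism of two
     such sheaves is the multiplication by a nonzero element of F.
   The smooth projective curve with function field K/k is encoded by its points
   [option (place iota)]: the places of K/k, and the generic point [None].     *)
From HB Require Import structures.
From mathcomp Require Import all_boot all_order all_algebra.
From mathcomp Require Import boolp classical_sets cardinality fsbigop.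

Set Implicit Arguments.
Unset Strict Implicit.
Unset Printing Implicit Defensive.

Import Order.TTheory GRing.Theory Num.Theory.
Local Open Scope classical_set_scope.
Local Open Scope ring_scope.

Section LocalRings.
Context {F : fieldType}.
Implicit Types (R A q I : set F).

(* The clause [x = 0] is needed because 0^-1 = 0 in MathComp. *)
Definition maxid R : set F := [set x | R x /\ (x = 0 \/ ~ R x^-1)].

Definition subring A : Prop :=
  [/\ A 1, forall x y, A x -> A y -> A (x - y) &
      forall x y, A x -> A y -> A (x * y)].

Definition subring_gen (B : set F) : set F :=
  [set x | forall A, subring A -> B `<=` A -> A x].

Definition prime_ideal A q : Prop :=
  [/\ q `<=` A, q 0, forall x y, q x -> q y -> q (x + y),
      forall x y, A x -> q y -> q (x * y) &
      ~ q 1 /\ forall x y, A x -> A y -> q (x * y) -> q x \/ q y].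

Definition localize A q : set F :=
  [set x | exists a b, [/\ A a, A b, ~ q b & x = a / b]].

Definition span R (B : set F) : set F :=
  [set x | exists (n : nat) (r b : 'I_n -> F),
     (forall i, R (r i) /\ B (b i)) /\ x = \sum_(i < n) r i * b i].

End LocalRings.

Definition dominates (F F' : fieldType) (emb : F' -> F) (R : set F) (R' : set F')
  : Prop :=
  forall a, R' a -> R (emb a) /\ (maxid R' a -> maxid R (emb a)).

Section Sheaves.
Context {F : fieldType}.
Implicit Types (S R : set F) (L I : set F -> set F).

Definition tensor L L' : set F -> set F :=
  fun R => span R [set z | exists x y, [/\ L R x, L' R y & z = x * y]].

Definition dual L : set F -> set F :=
  fun R => [set x | forall y, L R y -> R (x * y)].

Fixpoint tpow L (n : nat) : set F -> set F :=
  if n is m.+1 then tensor L (tpow L m) else fun R => R.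

Definition sheaf_iso (S : set (set F)) L L' : Prop :=
  exists2 g : F, g != 0 & forall R, S R -> L' R = [set g * x | x in L R].

(* The ideal sheaf of the zero scheme of a section s of the invertible sheaf L:
   the image of s : L^-1 -> O. *)
Definition zero_ideal (s : F) L : set F -> set F :=
  fun R => [set s * x | x in dual L R].

Definition radical I : set F -> set F :=
  fun R => [set x | R x /\ exists n : nat, I R (x ^+ n)].

(* A Cartier divisor is given by its local equations at every point; the sum of
   two divisors has the products of local equations as local equations. *)
Definition Cartier_of_ideal I : set F -> set F :=
  fun R => [set y | y != 0 /\ I R = [set x * y | x in R]].

Definition Cartier_add (A B : set F -> set F) : set F -> set F :=
  fun R => [set z | exists x y, [/\ A R x, B R y & z = x * y]].

Definition Cartier_sheaf (A : set F -> set F) : set F -> set F :=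
  fun R => [set x | exists2 y, A R y & R (x * y)].

(* The closed subscheme of S with ideal sheaf I (as a set of points of S), and
   its generic point, when it is irreducible. *)
Definition support (S : set (set F)) I : set (set F) :=
  [set R | S R /\ ~ I R 1].

Definition generic_point (Z : set (set F)) (eta : set F) : Prop :=
  Z eta /\ forall R, Z R -> R `<=` eta.

(* L|_Z = L (x) O/I for the integral closed subscheme Z with ideal I and generic
   point eta, as a subsheaf of the constant sheaf L_eta / I_eta L_eta on Z.
   A submodule of this quotient is encoded by its preimage in L_eta. *)
Definition restriction L I (eta : set F) : set F -> set F :=
  fun R => [set z | exists x y, [/\ L R x, tensor I L eta y & z = x + y]].

End Sheaves.

Definition pullback (F F' : fieldType) (emb : F' -> F) (S' : set (set F'))
    (L : set F' -> set F') : set F -> set F :=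
  fun R => [set x | exists R', [/\ S' R', dominates emb R R' &
                                  span R (emb @` L R') x]].

Section Curve.
Context {k : closedFieldType} {K : fieldType} (iota : {rmorphism k -> K}).

Definition function_field_of_curve : Prop :=
  exists x : K,
    (forall q : {poly k}, (map_poly iota q).[x] = 0 -> q = 0) /\
    exists (n : nat) (b : 'I_n -> K), forall y : K,
      exists (d : {poly k}) (c : 'I_n -> {poly k}),
        d != 0 /\
        (map_poly iota d).[x] * y = \sum_(i < n) (map_poly iota (c i)).[x] * b i.

(* Normalised discrete valuations of K/k; the junk value at 0 is fixed, so that
   distinct places are distinct valuations. *)
Record place := Place {
  ord :> K -> int;
  _ : ord 0 = 0;
  _ : forall x y, x != 0 -> y != 0 -> ord (x * y) = ord x + ord y;
  _ : forall x y, x != 0 -> y != 0 -> x + y != 0 ->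
        Num.min (ord x) (ord y) <= ord (x + y);
  _ : forall a, ord (iota a) = 0;
  _ : exists t, ord t = 1 }.

HB.instance Definition _ := gen_eqMixin place.
HB.instance Definition _ := gen_choiceMixin place.

Definition point : Type := option place.

Definition is_divisor (D : place -> int) : Prop := finite_set [set v | D v != 0].

Definition deg (D : place -> int) : int := \sum_(v \in [set: place]) D v.

Definition mul_div (n : int) (D : place -> int) : place -> int := fun v => n * D v.

Definition lin_equiv (D D' : place -> int) : Prop :=
  exists2 g : K, g != 0 & forall v, D v = D' v + ord v g.

Definition ord_ge (v : place) (n : int) (x : K) : Prop := x = 0 \/ n <= ord v x.

(* The stalks of O_C(D). *)
Definition OC (D : place -> int) (c : point) : set K :=
  if c is Some v then [set x | ord_ge v (- D v) x] else [set: K].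

Definition stalkC : point -> set K := OC (fun=> 0).

Definition derivation (d : K -> K) : Prop :=
  [/\ forall x y, d (x + y) = d x + d y,
      forall x y, d (x * y) = x * d y + y * d x &
      forall a, d (iota a) = 0].

(* Rational differential forms, as K-linear forms on Der_k(K, K); they agree
   with the elements of the K-line Omega_{K/k}. *)
Definition is_form (om : (K -> K) -> K) : Prop :=
  forall (a : K) d d', derivation d -> derivation d' ->
    om (fun x => a * d x + d' x) = a * om d + om d'.

Definition dform (f : K) : (K -> K) -> K := fun d => d f.

(* ord_v(om) >= n: if t is a uniformiser at v and d = d/dt, then
   om = om(d) dt. *)
Definition form_ord_ge (v : place) (n : int) (om : (K -> K) -> K) : Prop :=
  forall t d, derivation d -> ord v t = 1 -> d t = 1 -> ord_ge v n (om d).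

Definition regular_form (om : (K -> K) -> K) : Prop :=
  is_form om /\ forall v, form_ord_ge v 0 om.

(* dim_k H^0(C, Omega^1) = g *)
Definition has_genus (g : nat) : Prop :=
  exists om : 'I_g -> (K -> K) -> K,
    (forall i, regular_form (om i)) /\
    forall th, regular_form th ->
      exists! a : {ffun 'I_g -> k},
        forall d, derivation d -> th d = \sum_(i < g) iota (a i) * om i d.

Definition pre_Tango (p : nat) (D : place -> int) (f : K) : Prop :=
  [/\ is_divisor D, 0 < deg D, ~ (exists y, f = y ^+ p) &
      forall v, form_ord_ge v (p%:Z * D v) (dform f)].

(* (h v)_v represents eta(df) in H^1(C, L^-1) = (sum_v K / L^-1_v) / K, with
   L = O_C(D): locally at v, the section df of B^1 (x) L^-1 lifts to the section
   f - h_v^p of F_*O_C (x) L^-1 = F_*(L^-p), and two such lifts differ by p-th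
   powers of elements of L^-1. *)
Definition represents_eta (p : nat) (D : place -> int) (f : K) (h : place -> K)
  : Prop :=
  forall v, OC (mul_div (- p%:Z) D) (Some v) (f - h v ^+ p).

(* Rank 2 bundles on C are encoded as subsheaves of the constant sheaf
   K e_0 (+) K e_1.  This is the extension 0 -> O_C -> E -> L -> 0 with class
   (h v)_v: a section b of L lifts locally at v to b (h_v e_0 + e_1). *)
Definition extension (D : place -> int) (h : place -> K) (c : point)
  : set (K * K) :=
  if c is Some v then
    [set s | OC D c s.2 /\ stalkC c (s.1 - s.2 * h v)]
  else [set: K * K].

Definition frob_bundle (p : nat) (E : point -> set (K * K)) (c : point)
  : set (K * K) :=
  [set s | exists (n : nat) (r : 'I_n -> K) (u : 'I_n -> K * K),
     [/\ forall i, stalkC c (r i) /\ E c (u i),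
         s.1 = \sum_(i < n) r i * (u i).1 ^+ p &
         s.2 = \sum_(i < n) r i * (u i).2 ^+ p]].

(* The splitting L^p -> F^*E, b |-> b (tau e_0 + e_1). *)
Definition splits_frob (p : nat) (D : place -> int) (E : point -> set (K * K))
    (tau : K) : Prop :=
  forall c b, OC (mul_div p%:Z D) c b -> frob_bundle p E c (b * tau, b).

Section OverCurve.
Context {F : fieldType} (emb : K -> F).

Definition lies_over (R : set F) (c : point) : Prop := dominates emb R (stalkC c).

(* The subsheaf generated by the images of the sections of L under f; for
   f = emb this is the pullback of a subsheaf L of K. *)
Definition pull_gen (T : Type) (f : T -> F) (L : point -> set T)
  : set F -> set F :=
  fun R => [set x | exists2 c, lies_over R c & span R (f @` L c) x].

Definition pullC (L : point -> set K) : set F -> set F := pull_gen emb L.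

(* Pullback of a divisor on C. *)
Definition Cartier_pullC (D : place -> int) : set F -> set F :=
  fun R => [set y | exists c d, [/\ lies_over R c, d != 0,
     forall v, c = Some v -> ord v d = D v & y = emb d]].

(* Stalk at c of the direct image of a sheaf L on a set Z of points over C: the
   union, over the open neighbourhoods U of c (complements of finite sets T of
   closed points), of the sections of L over the preimage of U. *)
Definition pushforward (Z : set (set F)) (L : set F -> set F) (c : point)
  : set F :=
  [set x | exists T : set place,
     [/\ finite_set T, forall v, c = Some v -> ~ T v &
         forall R c', Z R -> lies_over R c' -> (forall v, c' = Some v -> ~ T v) ->
           L R x]].

End OverCurve.

(* The function field K(z), z = e_1 / e_0, of P(E), for E inside
   K e_0 (+) K e_1. *)
Definition KP : fieldType := {fraction {poly K}}.

Definition embP (a : K) : KP := FracField.tofrac a%:P.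

Definition zP : KP := FracField.tofrac 'X.

(* a e_0 + b e_1, divided by e_0: O_P(1) is identified with a subsheaf of the
   constant sheaf K(P) = K(P) e_0. *)
Definition lin (s : K * K) : KP := embP s.1 + embP s.2 * zP.

(* The coordinate ring of the open subset D_+(s) of Proj S(E_c). *)
Definition chart (E : point -> set (K * K)) (c : point) (s : K * K) : set KP :=
  subring_gen (embP @` stalkC c `|` [set lin s' / lin s | s' in E c]).

(* P(E) = Proj S(E): it is the union of its open subsets D_+(s), s in E. *)
Definition projE (E : point -> set (K * K)) : set (set KP) :=
  [set R | exists c s q,
     [/\ E c s, s != 0, prime_ideal (chart E c s) q,
         forall a, stalkC c a -> (q (embP a) <-> maxid (stalkC c) a) &
         R = localize (chart E c s) q]].

Definition O1 (E : point -> set (K * K)) : set KP -> set KP :=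
  pull_gen embP lin E.

(* The relative Frobenius P(E) -> P(F^*E), on function fields: the K-morphism
   taking z to z^p. *)
Definition rel_frob (p : nat) (x : KP) : KP :=
  FracField.tofrac ((frac (repr x)).1 \Po 'X^p)
  / FracField.tofrac ((frac (repr x)).2 \Po 'X^p).

End Curve.

Arguments KP : clear implicits.

(* The data defining a generalized Raynaud surface over the curve with function
   field K/k: L = O_C(rD), N = O_C(rN), N_l = N^(e/l) = O_C(rNl), e = re, l = rl.
   The splitting tau and the section sigma are determined by the other data (the
   latter up to k^* and to the choice of D and N in their linear equivalence
   class); rKX is the function field of the surface. *)
Record raynaud (k : closedFieldType) (K : fieldType) (iota : {rmorphism k -> K})
    (p : nat) := Raynaud {
  rD : place iota -> int;
  rf : K;
  rTango : pre_Tango p rD rf;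
  re : nat;
  re_ge2 : (2 <= re)%N;
  re_coprime : coprime re p;
  re_dvd : (re%:Z %| deg rD)%Z;
  rN : place iota -> int;
  rN_div : is_divisor rN;
  rN_ample : 0 < deg rN;
  rN_root : lin_equiv rD (mul_div re%:Z rN);
  rl : nat;
  rl_ge2 : (2 <= rl)%N;
  rl_dvdp : (rl %| p.+1)%N;
  rl_dvde : (rl %| re)%N;
  rh : place iota -> K;
  rhP : represents_eta p rD rf rh;
  rtau : K;
  rtauP : splits_frob p rD (extension rD rh) rtau;
  rNl : place iota -> int := mul_div (re %/ rl)%:Z rN;
  rE : point iota -> set (K * K) := extension rD rh;
  rP : set (set (KP K)) := projE rE;
  rEideal : set (KP K) -> set (KP K) := zero_ideal (lin (1, 0)) (O1 rE);
  (* the section curve Gamma' of P(F^*E), zero scheme of the section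
     tau e_0 + e_1 of O(1) (x) L^-p *)
  rGamma : set (KP K) -> set (KP K) :=
    zero_ideal (lin (rtau, 1))
      (tensor (O1 (frob_bundle p rE))
              (pullC (@embP K) (OC (mul_div (- p%:Z) rD))));
  rCideal : set (KP K) -> set (KP K) :=
    pullback (rel_frob p) (projE (frob_bundle p rE)) rGamma;
  rM : set (KP K) -> set (KP K) :=
    tensor (tpow (dual (O1 rE)) (p.+1 %/ rl))
           (pullC (@embP K) (OC (mul_div p%:Z rNl)));
  (* the section of M^-l with zero divisor E + C'' *)
  rsigma : KP K;
  rsigma_neq0 : rsigma != 0;
  rsigmaP : forall R, rP R ->
    [set rsigma * x | x in tpow rM rl R] = tensor rEideal rCideal R;
  (* the generic stalk K(P)[w] / (w^l - sigma) of the algebra (+)_i M^i, where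
     the local section m of M^i is written m w^i *)
  rKX : fieldType;
  rj : {rmorphism KP K -> rKX};
  rw : rKX;
  rwP : rw ^+ rl = rj rsigma;
  rKX_basis : forall x : rKX,
    exists! a : {ffun 'I_rl -> KP K}, x = \sum_(i < rl) rj (a i) * rw ^+ i }.

Section Surface.
Context (k : closedFieldType) (K : fieldType) (iota : {rmorphism k -> K})
  (p : nat) (S : raynaud iota p).

Definition cyclic_algebra (R : set (KP K)) : set (rKX S) :=
  [set x | exists a : 'I_(rl S) -> KP K,
     (forall i : 'I_(rl S), tpow (rM S) i R (a i)) /\
     x = \sum_(i < rl S) rj S (a i) * rw S ^+ i].

Definition surface : set (set (rKX S)) :=
  [set T | exists R q,
     [/\ rP S R, prime_ideal (cyclic_algebra R) q,
         forall a, R a -> (q (rj S a) <-> maxid R a) &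
         T = localize (cyclic_algebra R) q]].

Definition embX (a : K) : rKX S := rj S (embP a).

(* \tilde E *)
Definition Et_ideal : set (rKX S) -> set (rKX S) :=
  radical (pullback (rj S) (rP S) (rEideal S)).

Definition Et : set (set (rKX S)) := support surface Et_ideal.

Definition OX_Et : set (rKX S) -> set (rKX S) :=
  Cartier_sheaf (Cartier_of_ideal Et_ideal).

(* O_X(psi^-1(E) + phi^-1(D')) *)
Definition OX_Dt (D' : place iota -> int) : set (rKX S) -> set (rKX S) :=
  Cartier_sheaf
    (Cartier_add (Cartier_of_ideal Et_ideal) (Cartier_pullC embX D')).

(* v is a basis of the generic stalk V = O_X(Et)_eta / I_eta O_X(Et)_eta of
   phi_*(O_X(Et)|_Et), as a vector space over K. *)
Definition normal_frame (eta : set (rKX S)) (v : rKX S) : Prop :=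
  OX_Et eta v /\
  forall x, OX_Et eta x ->
    exists! a : K, tensor Et_ideal OX_Et eta (x - embX a * v).

(* phi_*(O_X(Et)|_Et), as a subsheaf of the constant sheaf K on C, through the
   isomorphism a |-> a v from K to V. *)
Definition normal_sheaf (eta : set (rKX S)) (v : rKX S) (c : point iota)
  : set K :=
  [set a | pushforward embX Et (restriction OX_Et Et_ideal eta) c (embX a * v)].

Definition sheafZ (eta : set (rKX S)) (v : rKX S) : set (rKX S) -> set (rKX S) :=
  tensor OX_Et (pullC embX (normal_sheaf eta v)).

End Surface.

Arguments surface {k K iota p} S.
Arguments embX {k K iota p} S.
Arguments Et {k K iota p} S.
Arguments OX_Et {k K iota p} S.
Arguments OX_Dt {k K iota p} S.
Arguments normal_frame {k K iota p} S.
Arguments sheafZ {k K iota p} S.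

(* Main.v *)
(* At the point of \tilde E over a point c of C, let d, n be generators of L and
   N_l and let u = 1/(d(z+h)) be an equation of E in P.  There C'' is empty,
   because its equation (z^p + tau)/(z+h)^p = 1 + d^p (tau - h^p) u^p is a unit.  As
   M is generated by m = u^q n^p with q = (p+1)/l, the element t = m w satisfies
   t^l = unit * u, so it is an equation of \tilde E, and
   t_c/t_c' restricts to (d'/d)^q (n/n')^p on \tilde E.  Hence the normal sheaf of
   \tilde E is q D - p N_l ~ (p+1) N_l - p N_l = N_l.  Restricting a function to
   \tilde E means applying the place "value at z = oo" of K(P), extended to K(X).
   A germ in K is a section over some open subset of C because it has finitely
   many zeros and poles, by the approximation theorem for places. *)
Require Import Defs.
From HB Require Import structures.
From mathcomp Require Import all_boot all_order all_algebra.
From mathcomp Require Import boolp classical_sets cardinality fsbigop.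
From mathcomp Require Import finmap zify ring.
(* Again, because MathComp also has a [span] and a [point]. *)
Import Defs.

Set Implicit Arguments.
Unset Strict Implicit.
Unset Printing Implicit Defensive.

Import Order.TTheory GRing.Theory Num.Theory.

(** * Places of a function field *)

Section Places.
Local Open Scope classical_set_scope.
Local Open Scope ring_scope.
Context {k : closedFieldType} {K : fieldType} {iota : {rmorphism k -> K}}.
Implicit Types (v w : place iota) (x y : K).

(** A point is its local ring, so the points of X on \tilde E have to be known as explicit subrings
    of K(X). Each is obtained by localising a chart at the functions whose value along the section
    lies in the maximal ideal of O_c. The harder half is uniqueness: every point of P on E over c,
    and every admissible prime of the cyclic algebra above it, yields this same subring. The generic
    point [None] of C is treated as one more c. Hence eta is the case c = [None], and generators at
    different points are compared inside the local ring at eta. Off \tilde E the ideal of \tilde E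
    is the unit ideal, so no equation has to be found there. The section sigma is known only through
    the ideal it generates; this is where the undetermined unit in t^l comes from. It does no harm,
    because w cancels in the ratios t_c/t_c', and only these enter the normal sheaf. The choice of a
    frame v of the generic stalk changes only one global factor in K. *)

Lemma ord0 v : ord v 0 = 0.
Proof. by case: v. Qed.

Lemma ordM v x y : x != 0 -> y != 0 -> ord v (x * y) = ord v x + ord v y.
Proof. by case: v => o /= ? H *; exact: H. Qed.

Lemma ordD v x y : x != 0 -> y != 0 -> x + y != 0 ->
  Num.min (ord v x) (ord v y) <= ord v (x + y).
Proof. by case: v => o /= ? ? H *; exact: H. Qed.

Lemma ord_iota v a : ord v (iota a) = 0.
Proof. by case: v. Qed.

Lemma ord_unif v : exists t, ord v t = 1.
Proof. by case: v. Qed.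

Lemma ord1 v : ord v 1 = 0.
Proof. by rewrite -(rmorph1 iota) ord_iota. Qed.

Lemma ordV v x : ord v x^-1 = - ord v x.
Proof.
have [->|x0] := eqVneq x 0; first by rewrite invr0 ord0 oppr0.
have := ordM v x0 (invr_neq0 x0); rewrite mulfV // ord1; lia.
Qed.

Lemma ordX v x n : ord v (x ^+ n) = n%:Z * ord v x.
Proof.
have [->|x0] := eqVneq x 0.
  by case: n => [|n]; rewrite ?expr0 ?ord1 ?mul0r // expr0n ord0 mulr0.
elim: n => [|n IH]; first by rewrite expr0 ord1 mul0r.
rewrite exprS ordM ?expf_neq0 // IH; lia.
Qed.

Lemma ordXz v x (n : int) : ord v (x ^ n) = n * ord v x.
Proof.
case: n => n; first by rewrite -exprnP ordX.
by rewrite NegzE -exprnN ordV ordX mulNr.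
Qed.

Lemma ordN v x : ord v (- x) = ord v x.
Proof.
have [->|x0] := eqVneq x 0; first by rewrite oppr0.
rewrite -mulN1r ordM ?oppr_eq0 ?oner_neq0 //.
by rewrite -(rmorphN1 iota) ord_iota add0r.
Qed.

Lemma ord_geE v n x : x != 0 -> ord_ge v n x <-> n <= ord v x.
Proof. by move=> x0; split=> [[/eqP|//]|]; [rewrite (negPf x0)|right]. Qed.

Lemma ord_geD v n x y : ord_ge v n x -> ord_ge v n y -> ord_ge v n (x + y).
Proof.
have [->|x0] := eqVneq x 0; first by rewrite add0r.
have [->|y0] := eqVneq y 0; first by rewrite addr0.
have [->|xy0] := eqVneq (x + y) 0; first by left.
move=> /ord_geE -/(_ x0) hx /ord_geE -/(_ y0) hy; right.
by have := ordD v x0 y0 xy0; lia.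
Qed.

Lemma ord_geN v n x : ord_ge v n x -> ord_ge v n (- x).
Proof. by case=> [->|h]; [left; rewrite oppr0|right; rewrite ordN]. Qed.

Lemma ord_geM v m n x y : ord_ge v m x -> ord_ge v n y -> ord_ge v (m + n) (x * y).
Proof.
have [->|x0] := eqVneq x 0; first by left; rewrite mul0r.
have [->|y0] := eqVneq y 0; first by left; rewrite mulr0.
move=> /ord_geE -/(_ x0) hx /ord_geE -/(_ y0) hy; right.
by rewrite ordM // lerD.
Qed.

Lemma ord_ge_sum v n (I : Type) (r : seq I) (P : pred I) (f : I -> K) :
  (forall i, P i -> ord_ge v n (f i)) -> ord_ge v n (\sum_(i <- r | P i) f i).
Proof. by move=> h; elim/big_ind: _ => //; [left|exact: ord_geD]. Qed.

Lemma ordD_lt v x y : x != 0 -> ord_ge v (ord v x + 1) y ->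
  x + y != 0 /\ ord v (x + y) = ord v x.
Proof.
move=> x0; have [->|y0] := eqVneq y 0; first by rewrite addr0.
move=> /ord_geE -/(_ y0) h.
have xy0 : x + y != 0.
  by apply: contraPneq h => /eqP; rewrite addr_eq0 => /eqP ->; rewrite ordN; lia.
split=> //; have := ordD v x0 y0 xy0.
have := @ordD v (x + y) (- y) xy0.
by rewrite oppr_eq0 ordN addrK => /(_ y0 x0); lia.
Qed.

Lemma place_eq v w : (forall x, ord v x = ord w x) -> v = w.
Proof.
move=> h; have {h} : ord v = ord w by apply: funext.
case: v => o1 a1 b1 c1 d1 e1; case: w => o2 a2 b2 c2 d2 e2 /= eo.
by subst o2; congr Place; exact: Prop_irrelevance.
Qed.

(** A unit at v is a unit at w, so ord w is ord v times the constant ord w t, for t a uniformiser at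
    v. As w is normalised and takes the value 1, this constant is 1. *)
Lemma place_sub v w : (forall x, 0 <= ord v x -> 0 <= ord w x) -> v = w.
Proof.
move=> h; have [t vt] := ord_unif v; have [s ws] := ord_unif w.
have t0 : t != 0 by apply/eqP => t0; move: vt; rewrite t0 ord0.
have u x : ord v x = 0 -> ord w x = 0.
  move=> vx; have := h x; have := h x^-1; rewrite !ordV vx; lia.
have hw x : ord w x = ord v x * ord w t.
  have [->|x0] := eqVneq x 0; first by rewrite !ord0 mul0r.
  have : ord v (x * t ^ (- ord v x)) = 0.
    by rewrite ordM ?expfz_neq0 // ordXz vt; lia.
  by move=> /u; rewrite ordM ?expfz_neq0 // ordXz; lia.
apply: place_eq => x; rewrite hw; suff -> : ord w t = 1 by rewrite mulr1.
have ht : 0 <= ord w t by apply: h; rewrite vt.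
have := hw s; rewrite ws => hs.
have : 0 < ord v s by nia.
move=> hv; have : ~ 2 <= ord w t by nia. nia.
Qed.

Lemma place_separate v w : v <> w -> exists x, [/\ x != 0, 0 <= ord v x & ord w x < 0].
Proof.
move=> vw; apply: contrapT => h; apply: vw; apply: place_sub => x vx.
have [->|x0] := eqVneq x 0; first by rewrite ord0.
by rewrite leNgt; apply/negP => wx; apply: h; exists x.
Qed.

(** Induction on s. If the x found for the tail has no pole at the new place w, it is replaced by
    x^N + y, where y = a / b vanishes at v and has a pole at w. *)
Lemma place_separate_seq v (s : seq (place iota)) : v \notin s ->
  exists x, [/\ x != 0, 0 < ord v x & forall w, w \in s -> ord w x < 0].
Proof.
elim: s => [_|w s IH].
  have [t vt] := ord_unif v; exists t; split=> //; last by rewrite vt.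
  by apply/eqP => t0; move: vt; rewrite t0 ord0.
rewrite inE negb_or => /andP[/eqP vw /IH[x [x0 vx sx]]].
have [a [a0 va wa]] := place_separate vw.
have [b [b0 wb vb]] := place_separate (fun e => vw (esym e)).
pose y := a / b; have y0 : y != 0 by rewrite mulf_neq0 ?invr_neq0.
have vy : 0 < ord v y by rewrite ordM ?invr_neq0 // ordV; lia.
have wy : ord w y < 0 by rewrite ordM ?invr_neq0 // ordV; lia.
have [wx|wx] := ltrP (ord w x) 0.
  by exists x; split=> // u; rewrite inE => /orP[/eqP ->|/sx].
move: y y0 vy wy => y y0 vy wy.
(* With N above every |ord u y| on s, the poles of x^N dominate those of y there, while at w the
   term y dominates. *)
have [N N0 hN] : exists2 N, (0 < N)%N & forall u, u \in s -> (`|ord u y| < N)%N.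
  exists (\sum_(u <- s) `|ord u y|).+1%N => // u us.
  by rewrite ltnS (big_rem u us) /= leq_addr.
have xN0 : x ^+ N != 0 by rewrite expf_neq0.
have [q0 qw] : x ^+ N + y != 0 /\ ord w (x ^+ N + y) = ord w y.
  rewrite addrC; apply: ordD_lt => //; right; rewrite ordX; nia.
exists (x ^+ N + y); split=> //.
  have := ordD v xN0 y0 q0; have : 0 < ord v (x ^+ N) by rewrite ordX; nia.
  by move=> h; apply: lt_le_trans; rewrite lt_min h.
move=> u; rewrite inE => /orP[/eqP ->|us]; first by rewrite qw.
have ux := sx _ us.
have {}hN := hN _ us.
have [_ ->] : x ^+ N + y != 0 /\ ord u (x ^+ N + y) = ord u (x ^+ N).
  apply: ordD_lt => //; right; rewrite ordX; nia.
by rewrite ordX; nia.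
Qed.

(** Take 1 / (1 + x), with x vanishing at v and having a pole at each place of s. *)
Lemma place_approx v (s : seq (place iota)) : v \notin s ->
  exists y, [/\ y != 0, ord v y = 0 & forall w, w \in s -> 0 < ord w y].
Proof.
move=> /place_separate_seq[x [x0 vx sx]].
have one0 := oner_neq0 K.
have [h0 vh] : 1 + x != 0 /\ ord v (1 + x) = ord v 1.
  by apply: ordD_lt => //; right; rewrite ord1; lia.
exists (1 + x)^-1; split; rewrite ?invr_eq0 ?ordV ?vh ?ord1 //.
move=> w /sx wx; rewrite ordV addrC.
have [_ ->] : x + 1 != 0 /\ ord w (x + 1) = ord w x.
  by apply: ordD_lt => //; right; rewrite ord1; lia.
lia.
Qed.

End Places.

(** * Fractions over a domain and linear dependence *)

Section Fractions.
Local Open Scope ring_scope.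
Local Open Scope quotient_scope.
Variable A : idomainType.

Local Notation tofrac := (@FracField.tofrac A).

Lemma tofrac_repr (y : {fraction A}) :
  y = tofrac (frac (repr y)).1 / tofrac (frac (repr y)).2.
Proof.
set r := repr y; have d0 : (frac r).2 != 0 := denom_ratioP r.
apply: (canRL (mulfK _)); first by rewrite tofrac_eq0.
rewrite -[y]reprK -/r; unlock FracField.tofrac; rewrite -[LHS]FracField.pi_mul.
apply/eqmodP; rewrite /= -/(equivf _ _) FracField.equivfE /FracField.mulf.
by rewrite !numden_Ratio ?mulr1 ?mul1r ?oner_neq0 // mulrC.
Qed.

Lemma tofrac_surj (y : {fraction A}) :
  exists n d, d != 0 /\ y = tofrac n / tofrac d.
Proof.
exists (frac (repr y)).1, (frac (repr y)).2.
by split; [exact: denom_ratioP|exact: tofrac_repr].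
Qed.

(** A kernel vector exists over the fraction field by rank; multiplying it by the product of all its
    denominators brings it into the domain. *)
Lemma left_kernel m n (M : 'M[A]_(m, n)) : (n < m)%N ->
  exists2 v : 'rV[A]_m, v != 0 & v *m M = 0.
Proof.
move=> nm; pose N := map_mx tofrac M.
have : kermx N != 0.
  rewrite -mxrank_eq0 mxrank_ker -lt0n subn_gt0.
  exact: leq_ltn_trans (rank_leq_col N) nm.
case/rowV0Pn => u /sub_kermxP uN /rV0Pn[i0 ui0].
pose d i := (frac (repr (u 0 i))).2; pose b := \prod_i d i.
have d0 i : d i != 0 by exact: denom_ratioP.
have b0 : b != 0 by apply/prodf_neq0.
have aux (F : fieldType) (a e n1 : F) : e != 0 -> n1 * a = e * a * (n1 / e).
  by move=> e0; rewrite mulrAC mulrCA mulfV // mulr1.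
pose v := \row_i ((frac (repr (u 0 i))).1 * \prod_(j | j != i) d j).
have uv : map_mx tofrac v = tofrac b *: u.
  apply/rowP => i; rewrite !mxE [in RHS](tofrac_repr (u 0 i)) -/(d i).
  rewrite [in RHS]/b [in RHS](bigD1 i) /=; last by []. rewrite !tofracM.
  apply: aux; by rewrite tofrac_eq0.
exists v.
  apply: contraNneq ui0 => v0; have /matrixP/(_ 0 i0) := uv.
  rewrite v0 !mxE tofrac0 => /esym/eqP; rewrite mulf_eq0 tofrac_eq0.
  by rewrite (negPf b0).
have : map_mx tofrac (v *m M) = 0 by rewrite map_mxM uv -scalemxAl uN scaler0.
move=> /matrixP h; apply/matrixP => i j; have := h i j; rewrite !mxE.
by move=> /eqP; rewrite tofrac_eq0 => /eqP.
Qed.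

End Fractions.

(** * Finiteness of zeros and poles *)

Section Divisors.
Local Open Scope classical_set_scope.
Local Open Scope ring_scope.
Context {k : closedFieldType} {K : fieldType} {iota : {rmorphism k -> K}}.
Variables (x : K) (n : nat) (b : 'I_n -> K).
Implicit Types (a q : {poly k}) (v : place iota).

Local Notation ev a := (map_poly iota a).[x].

Hypothesis ev_inj : forall a, ev a = 0 -> a = 0.
Hypothesis b_gen : forall y, exists (d : {poly k}) (c : 'I_n -> {poly k}),
  d != 0 /\ ev d * y = \sum_(i < n) ev (c i) * b i.

(** Expand each [d i * y i] in the n generators [b]; a left kernel vector v of the coefficient
    matrix gives the relation with coefficients [v i * d i]. *)
Lemma poly_dependence m (y : 'I_m -> K) : (n < m)%N ->
  exists2 a : 'I_m -> {poly k},
    (exists i, a i != 0) & \sum_i ev (a i) * y i = 0.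
Proof.
move=> nm; have /choice[d /choice[c h]] := fun i => b_gen (y i).
have [v /rV0Pn[i0 vi0] vM] := left_kernel (\matrix_(i, j) c i j) nm.
exists (fun i => v 0 i * d i).
  by exists i0; rewrite mulf_neq0 //; case: (h i0).
under eq_bigr do rewrite rmorphM hornerM -mulrA (proj2 (h _)) mulr_sumr.
rewrite exchange_big /= big1 // => j _.
under eq_bigr do rewrite mulrA -hornerM -rmorphM.
have -> : \sum_i (map_poly iota (v 0 i * c i j)).[x] * b j =
    ev (\sum_i v 0 i * c i j) * b j by rewrite -mulr_suml rmorph_sum horner_sum.
suff -> : \sum_i v 0 i * c i j = 0 by rewrite rmorph0 horner0 mul0r.
have /matrixP/(_ 0 j) := vM; rewrite !mxE => vM0; rewrite -[RHS]vM0.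
by apply: eq_bigr => i _; rewrite mxE.
Qed.

Lemma ev_neq0 a : a != 0 -> ev a != 0.
Proof. by apply: contra_neq; exact: ev_inj. Qed.

(* Approximants y_i with v_i(y_i) = 0 and v_j(y_i) > 0 for j != i are linearly
   independent over k(x) when the v_i restrict to multiples of one valuation. *)
Lemma place_count (mu : {poly k} -> int) (s : seq (place iota)) :
  uniq s ->
  (forall v, v \in s -> exists2 e : int, 0 < e &
     forall a, a != 0 -> ord v (ev a) = e * mu a) ->
  (size s <= n)%N.
Proof.
move=> us hs; rewrite leqNgt; apply/negP => ns.
pose vi := tnth (in_tuple s).
have /choice[y yP] (i : 'I_(size s)) : exists y, [/\ y != 0, ord (vi i) y = 0 &
    forall j, j != i -> 0 < ord (vi j) y].
  have /place_approx[y [y0 yi ys]] : vi i \notin rem (vi i) s.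
    by rewrite mem_rem_uniq // inE eqxx.
  exists y; split=> // j ji; apply: ys; rewrite mem_rem_uniq // inE mem_tnth andbT.
  by apply: contra ji => /eqP/(tuple_uniqP (in_tuple s) us) ->.
have [a [i1 ai1] asum] := poly_dependence y ns.
(* Where [mu (a i)] is least, the i-th term has at v_i an order strictly below that of all other
   terms, so the sum cannot vanish. *)
case: (@arg_minP _ _ _ i1 (fun i => a i != 0) (fun i => mu (a i))) => // i ai0 imin.
have [e e0 he] := hs (vi i) (mem_tnth _ _).
have [yi0 vyi _] := yP i.
suff [+ _] : ev (a i) * y i + \sum_(j | j != i) ev (a j) * y j != 0 /\
    ord (vi i) (ev (a i) * y i + \sum_(j | j != i) ev (a j) * y j) =
    ord (vi i) (ev (a i) * y i).
  by move: asum; rewrite (bigD1 i) //= => ->; rewrite eqxx.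
have evi := ev_neq0 ai0.
apply: ordD_lt; first by rewrite mulf_neq0.
rewrite ordM // vyi addr0 he //; apply: ord_ge_sum => j ji.
have [->|aj0] := eqVneq (a j) 0; first by left; rewrite rmorph0 horner0 mul0r.
have [yj0 _ /(_ i)] := yP j; rewrite eq_sym => /(_ ji) vyj.
right; rewrite ordM ?ev_neq0 // he //.
have := imin j aj0; nia.
Qed.

Lemma finite_place_set (mu : {poly k} -> int) (A : set (place iota)) :
  (forall v, A v -> exists2 e : int, 0 < e &
     forall a, a != 0 -> ord v (ev a) = e * mu a) ->
  finite_set A.
Proof.
move=> h; apply: contrapT => /(@infinite_set_fset _ _ n.+1)[B BA].
rewrite leqNgt ltnS; apply/negP; rewrite negbK.
apply: (place_count (fset_uniq B) (mu := mu)) => v vB; apply: h; exact: BA.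
Qed.

Lemma ev_ge0 v a : ord_ge v 0 x -> ord_ge v 0 (ev a).
Proof.
move=> vx; elim/poly_ind: a => [|a c IH]; first by left; rewrite rmorph0 horner0.
rewrite rmorphD rmorphM /= map_polyX map_polyC !hornerE.
by apply: ord_geD; [exact: ord_geM IH vx|right; rewrite ord_iota].
Qed.

(** On k[x] such a place is e times the multiplicity at [al], with e = ord v (x - al): a cofactor q
    with q(al) != 0 is q(al) plus a multiple of x - al, hence a unit at v. *)
Lemma finite_zeros_XsubC (al : k) : finite_set [set v : place iota | 0 < ord v (x - iota al)].
Proof.
apply: (@finite_place_set (fun a => (mup al a)%:Z)) => v /= vx.
exists (ord v (x - iota al)) => // a a0.
have [m [q]] := multiplicity_XsubC a al; rewrite a0 /= => qal aE.
have q0 : q != 0 by apply: contraNneq qal => ->; exact: root0.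
have xal0 : x - iota al != 0 by apply: contraTneq vx => ->; rewrite ord0 ltxx.
rewrite aE mupM ?expf_neq0 ?polyXsubC_eq0 // mupNroot // mup_XsubCX eqxx add0n.
rewrite rmorphM rmorphXn /= hornerM horner_exp map_polyXsubC hornerXsubC.
rewrite ordM ?ordX ?expf_neq0 ?ev_neq0 // mulrC [X in X + _](_ : _ = 0) ?add0r //.
have /factor_theorem[r] : root (q - q.[al]%:P) al.
  by rewrite /root !hornerE subrr.
move/(canRL (subrK _)) => ->.
rewrite rmorphD rmorphM /= map_polyXsubC map_polyC !hornerE addrC.
have qal0 : iota q.[al] != 0 by rewrite fmorph_eq0.
have [//|_ ->] := @ordD_lt _ _ _ v (iota q.[al]) ((map_poly iota r).[x] * (x - iota al)) qal0; last first.
  exact: ord_iota.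
rewrite ord_iota add0r; apply: (@ord_geM _ _ _ v 0 1); last by right.
apply: ev_ge0; rewrite -(subrK (iota al) x); apply: ord_geD.
  by right; apply: ltW.
by right; rewrite ord_iota.
Qed.

(** At a pole of x of order e the leading term dominates, so a(x) has order - e deg a; for a
    nonzero, - deg a is [1 - size a]. *)
Lemma finite_poles_gen : finite_set [set v : place iota | ord v x < 0].
Proof.
apply: (@finite_place_set (fun a => 1 - (size a)%:Z)) => v /= vx.
exists (- ord v x); first by rewrite oppr_gt0.
have x0 : x != 0 by apply: contraTneq vx => ->; rewrite ord0 ltxx.
elim/poly_ind => [|a c IH]; first by rewrite eqxx.
rewrite rmorphD rmorphM /= map_polyX map_polyC !hornerE size_MXaddC.
have [->|a0 ac0] := eqVneq a 0.
  rewrite rmorph0 horner0 !mul0r !add0r ord_iota polyC_eq0 => /negPf -> /=.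
  by rewrite size_poly0 subrr mulr0.
have ha := IH a0; have sa : (0 < size a)%N by rewrite size_poly_gt0.
have ea : ev a * x != 0 by rewrite mulf_neq0 // ev_neq0.
have oa : ord v (ev a * x) = - ord v x * (1 - (size a).+1%:Z).
  by rewrite ordM ?ev_neq0 // ha -[_.+1]addn1 PoszD; ring.
have [//|_ ->] := @ordD_lt _ _ _ v (ev a * x) (iota c) ea; last by rewrite /= oa.
by right; rewrite ord_iota oa; nia.
Qed.

(** The n + 1 powers 1, ..., y^n satisfy a relation over k[x]. Away from the poles of x and the
    zeros of its top coefficient, y is integral. As k is algebraically closed, these zeros are zeros
    of some x - al. *)
Lemma finite_poles (y : K) : finite_set [set v : place iota | ord v y < 0].
Proof.
have [y0|y0] := eqVneq y 0.
  by rewrite y0 [X in finite_set X](_ : _ = set0) // -subset0 => v /=; rewrite ord0 ltxx.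
have [a [i1 ai1] asum] := @poly_dependence n.+1 (fun i => y ^+ i) (ltnSn n).
case: (@arg_maxP _ _ _ i1 (fun i => a i != 0) (fun i => i)) => // i ai0 imax.
have [r ri] := closed_field_poly_normal (a i).
apply: (@sub_finite_set _ _ ([set v : place iota | ord v x < 0] `|`
  \bigcup_(al in [set` r]) [set v : place iota | 0 < ord v (x - iota al)])); last first.
  rewrite finite_setU; split; first exact: finite_poles_gen.
  by apply: bigcup_finite => [|al _]; [exact: finite_seq|exact: finite_zeros_XsubC].
move=> v /= vy; apply: contrapT => /not_orP[/negP]; rewrite -leNgt => vx vr.
have xge : ord_ge v 0 x by right.
have vai : ord v (ev (a i)) = 0.
  rewrite ri map_polyZ hornerZ.
  have : all (fun al => ~~ (0 < ord v (x - iota al))) r.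
    by apply/allP => al alr; apply/negP => h; apply: vr; exists al.
  have l0 : iota (lead_coef (a i)) != 0 by rewrite fmorph_eq0 lead_coef_eq0.
  suff h s : all (fun al => ~~ (0 < ord v (x - iota al))) s ->
      (map_poly iota (\prod_(z <- s) ('X - z%:P))).[x] != 0 /\
      ord v (map_poly iota (\prod_(z <- s) ('X - z%:P))).[x] = 0.
    by move=> /h[h1 h2]; rewrite ordM // h2 ord_iota.
  elim: s => [_|z s IH /= /andP[hz /IH[h1 h2]]].
    by rewrite big_nil rmorph1 hornerE ord1 oner_neq0.
  rewrite big_cons rmorphM /= map_polyXsubC hornerM hornerXsubC.
  have xz : x - iota z != 0.
    have := @ev_neq0 ('X - z%:P); rewrite polyXsubC_eq0 map_polyXsubC hornerXsubC.
    exact.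
  split; first by rewrite mulf_neq0.
  rewrite ordM // h2 addr0; apply/eqP; rewrite eq_le leNgt hz /=.
  have : ord_ge v 0 (x - iota z).
    by apply: ord_geD => //; apply: ord_geN; right; rewrite ord_iota.
  by move/ord_geE; exact.
have evi : ev (a i) * y ^+ i != 0 by rewrite mulf_neq0 ?expf_neq0 ?ev_neq0.
(* If y had a pole at v, the top term would have the strictly smallest order and the relation could
   not vanish. *)
have [] := @ordD_lt _ _ _ v (ev (a i) * y ^+ i)
    (\sum_(j | j != i) ev (a j) * y ^+ j) evi; last first.
  by move: asum; rewrite (bigD1 i) //= => ->; rewrite eqxx.
rewrite ordM ?expf_neq0 ?ev_neq0 // vai add0r; apply: ord_ge_sum => j ji.
have [->|aj0] := eqVneq (a j) 0; first by left; rewrite rmorph0 horner0 mul0r.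
rewrite -[X in ord_ge _ X]add0r; apply: ord_geM; first exact: ev_ge0.
have lij : (j < i)%N.
  by rewrite ltn_neqAle ji; exact: imax.
by right; rewrite !ordX; nia.
Qed.

Lemma finite_ord (y : K) : finite_set [set v : place iota | ord v y != 0].
Proof.
apply: (@sub_finite_set _ _ ([set v : place iota | ord v y < 0] `|` [set v : place iota | ord v y^-1 < 0])).
  by move=> v /=; rewrite ordV => h; have [?|?] := ltrP (ord v y) 0; [left|right; lia].
by rewrite finite_setU; split; exact: finite_poles.
Qed.

End Divisors.

Section FunctionField.
Local Open Scope ring_scope.
Lemma function_field_finite_ord (k : closedFieldType) (K : fieldType)
    (iota : {rmorphism k -> K}) (y : K) :
  function_field_of_curve iota -> finite_set [set v : place iota | ord v y != 0].
Proof. by case=> x [xt [n [b hb]]]; exact: (finite_ord (b := b) xt). Qed.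
End FunctionField.

(** * Local rings composed with a place *)

Section Subrings.
Local Open Scope classical_set_scope.
Local Open Scope ring_scope.
Context {F : fieldType}.
Implicit Types (R A q B M : set F) (x y z : F).

Lemma subring1 A : subring A -> A 1.
Proof. by case. Qed.

Lemma subringB A x y : subring A -> A x -> A y -> A (x - y).
Proof. by case=> _ h _; exact: h. Qed.

Lemma subringM A x y : subring A -> A x -> A y -> A (x * y).
Proof. by case=> _ _ h; exact: h. Qed.

Lemma subring0 A : subring A -> A 0.
Proof. by move=> sA; rewrite -(subrr 1); apply: subringB => //; exact: subring1. Qed.

Lemma subringN A x : subring A -> A x -> A (- x).
Proof. by move=> sA Ax; rewrite -sub0r; apply: subringB => //; exact: subring0. Qed.

Lemma subringD A x y : subring A -> A x -> A y -> A (x + y).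
Proof. by move=> sA Ax Ay; rewrite -[y]opprK; apply: subringB => //; exact: subringN. Qed.

Lemma subringX A x n : subring A -> A x -> A (x ^+ n).
Proof.
move=> sA Ax; elim: n => [|n IH]; first by rewrite expr0; exact: subring1.
by rewrite exprS; exact: subringM.
Qed.

Lemma subring_sum A (I : Type) (r : seq I) (P : pred I) (f : I -> F) :
  subring A -> (forall i, P i -> A (f i)) -> A (\sum_(i <- r | P i) f i).
Proof.
by move=> sA h; elim/big_ind: _ => // [|x y]; [exact: subring0|exact: subringD].
Qed.

Lemma subring_gen_subring B : subring (subring_gen B).
Proof.
split=> [A sA _|x y hx hy A sA BA|x y hx hy A sA BA]; first exact: subring1.
- by apply: subringB => //; [exact: hx|exact: hy].
- by apply: subringM => //; [exact: hx|exact: hy].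
Qed.

Lemma subset_gen B : B `<=` subring_gen B.
Proof. by move=> x Bx A _; apply. Qed.

Definition submodule R M : Prop :=
  [/\ M 0, forall x y, M x -> M y -> M (x + y) & forall x y, R x -> M y -> M (x * y)].

Lemma span_min R B M : submodule R M -> B `<=` M -> span R B `<=` M.
Proof.
case=> M0 MD Mm BM x [n [r [b [h ->]]]].
elim/big_ind: _ => // i _; apply: Mm; first by case: (h i).
by apply: BM; case: (h i).
Qed.

Lemma sub_span R B : R 1 -> B `<=` span R B.
Proof.
move=> R1 x Bx; exists 1%N, (fun=> 1), (fun=> x); split=> //.
by rewrite big_ord1 mul1r.
Qed.

Lemma span_submodule R B : subring R -> submodule R (span R B).
Proof.
move=> sR; split.
- exists 0%N, (fun=> 0), (fun=> 0); split; first by case.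
  by rewrite big_ord0.
- move=> x y [m [r [b [h ->]]]] [n [r' [b' [h' ->]]]].
  exists (m + n)%N, (fun i => match split i with inl i => r i | inr i => r' i end),
    (fun i => match split i with inl i => b i | inr i => b' i end); split.
    by move=> i; case: split => j; [exact: h|exact: h'].
  rewrite big_split_ord /=; congr (_ + _); apply: eq_bigr => i _.
    by rewrite -[lshift n i]/(unsplit (inl i)) unsplitK.
  by rewrite -[rshift m i]/(unsplit (inr i)) unsplitK.
- move=> x y Rx [n [r [b [h ->]]]]; exists n, (fun i => x * r i), b; split.
    by move=> i; have [? ?] := h i; split=> //; exact: subringM.
  by rewrite mulr_sumr; apply: eq_bigr => i _; rewrite mulrA.
Qed.

Lemma subring_submodule R : subring R -> submodule R R.
Proof.
by move=> sR; split=> [|x y|x y]; [exact: subring0|exact: subringD|exact: subringM].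
Qed.

Lemma span_sub_subring R B : subring R -> B `<=` R -> span R B `<=` R.
Proof. by move=> sR; apply: span_min; exact: subring_submodule. Qed.

Definition prin R x : set F := [set x * y | y in R].

Lemma prinE R x z : x != 0 -> prin R x z <-> R (z / x).
Proof.
move=> x0; split=> [[y Ry <-]|h]; first by rewrite mulrAC mulfV // mul1r.
by exists (z / x) => //; rewrite mulrC divfK.
Qed.

Lemma prin1 R : prin R 1 = R.
Proof.
apply/seteqP; split=> [x [y Ry <-]|x Rx]; first by rewrite mul1r.
by exists x; rewrite ?mul1r.
Qed.

Lemma prin_submodule R x : subring R -> submodule R (prin R x).
Proof.
move=> sR; split.
- by exists 0; rewrite ?mulr0 //; exact: subring0.
- by move=> _ _ [a Ra <-] [b Rb <-]; exists (a + b); [exact: subringD|rewrite mulrDr].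
- by move=> y _ Ry [a Ra <-]; exists (y * a); [exact: subringM|rewrite mulrCA].
Qed.

Lemma span_prin R B x : subring R -> B x -> B `<=` prin R x -> span R B = prin R x.
Proof.
move=> sR Bx BR; apply/seteqP; split.
  by apply: span_min => //; exact: prin_submodule.
move=> _ [y Ry <-]; rewrite mulrC; have [_ _ h] := span_submodule B sR.
by apply: h => //; apply: sub_span => //; exact: subring1.
Qed.

Lemma tensor_prin (L L' : set F -> set F) R x y : subring R ->
  L R = prin R x -> L' R = prin R y -> tensor L L' R = prin R (x * y).
Proof.
move=> sR Lx Ly; apply: span_prin => //=.
  exists x, y; rewrite Lx Ly; split=> //.
    by exists 1; [exact: subring1|rewrite mulr1].
  by exists 1; [exact: subring1|rewrite mulr1].
move=> z [a [b []]]; rewrite Lx Ly => -[c Rc <-] [d Rd <-] ->.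
by exists (c * d); [exact: subringM|rewrite mulrACA].
Qed.

Lemma dual_prin (L : set F -> set F) R x : subring R -> x != 0 ->
  L R = prin R x -> dual L R = prin R x^-1.
Proof.
move=> sR x0 Lx; apply/seteqP; split=> z.
  move=> h; apply/prinE; rewrite ?invr_eq0 // invrK; apply: h.
  by rewrite Lx; exists 1; [exact: subring1|rewrite mulr1].
move=> [a Ra <-] y; rewrite Lx => -[b Rb <-].
by rewrite mulrACA mulVf // mul1r; exact: subringM.
Qed.

Lemma tpow_prin (L : set F -> set F) R x n : subring R ->
  L R = prin R x -> tpow L n R = prin R (x ^+ n).
Proof.
move=> sR Lx; elim: n => [|n IH]; first by rewrite expr0 prin1.
by rewrite exprS; exact: tensor_prin.
Qed.

Lemma prime_subset A q x : prime_ideal A q -> q x -> A x.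
Proof. by case=> h _ _ _ _; exact: h. Qed.

Lemma primeM A q x y : prime_ideal A q -> A x -> A y -> ~ q x -> ~ q y -> ~ q (x * y).
Proof. by case=> _ _ _ _ [_ h] Ax Ay qx qy /(h _ _ Ax Ay) []. Qed.

Lemma prime_neq0 A q x : prime_ideal A q -> ~ q x -> x != 0.
Proof. by case=> _ q0 _ _ _; apply: contra_notN => /eqP ->. Qed.

Lemma prime_notin1 A q : prime_ideal A q -> ~ q 1.
Proof. by case=> _ _ _ _ []. Qed.

Lemma localize_subring A q : subring A -> prime_ideal A q -> subring (localize A q).
Proof.
move=> sA qP; split.
- exists 1, 1; rewrite divr1; split; rewrite //; try exact: subring1.
  exact: prime_notin1 qP.
- move=> _ _ [a [b [Aa Ab qb ->]]] [c [d [Ac Ad qd ->]]].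
  have [b0 d0] := (prime_neq0 qP qb, prime_neq0 qP qd).
  exists (a * d - c * b), (b * d); split.
  + by apply: subringB => //; exact: subringM.
  + exact: subringM.
  + exact: primeM qP _ _ qb qd.
  + by rewrite -mulNr addf_div // mulNr.
- move=> _ _ [a [b [Aa Ab qb ->]]] [c [d [Ac Ad qd ->]]].
  exists (a * c), (b * d); split; try exact: subringM.
  + exact: primeM qP _ _ qb qd.
  + by rewrite mulf_div.
Qed.

Lemma sub_localize A q : subring A -> prime_ideal A q -> A `<=` localize A q.
Proof.
move=> sA qP x Ax; exists x, 1; rewrite divr1; split=> //; first exact: subring1.
exact: prime_notin1 qP.
Qed.

Lemma localize_maxid A q x : subring A -> prime_ideal A q -> q x ->
  maxid (localize A q) x.
Proof.
move=> sA qP qx; have Ax := prime_subset qP qx; split; first exact: sub_localize.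
have [->|x0] := eqVneq x 0; [by left|right].
move=> [a [b [Aa Ab qb h]]]; have b0 := prime_neq0 qP qb.
apply: qb; have -> : b = a * x by rewrite -[a](divfK b0) -h mulrAC mulVf // mul1r.
by case: qP => _ _ _ + _; apply.
Qed.

Lemma localize_inv A q x : prime_ideal A q -> subring A -> A x -> ~ q x ->
  localize A q x^-1.
Proof.
by move=> qP sA Ax qx; exists 1, x; split=> //; [exact: subring1|rewrite mul1r].
Qed.

End Subrings.

Section Domination.
Local Open Scope classical_set_scope.
Local Open Scope ring_scope.

Lemma localize_dominates (F F' : fieldType) (f : F' -> F) (A q : set F) (R : set F') :
  subring A -> prime_ideal A q -> (forall a, R a -> A (f a)) ->
  (forall a, R a -> maxid R a -> q (f a)) -> dominates f (localize A q) R.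
Proof.
move=> sA qP fA fq a Ra; split; first by apply: sub_localize => //; exact: fA.
by move=> /(fq _ Ra); exact: localize_maxid.
Qed.

Lemma dominates_trans (F F' F'' : fieldType) (f : F' -> F) (g : F'' -> F')
  (R : set F) (R' : set F') (R'' : set F'') :
  dominates f R R' -> dominates g R' R'' -> dominates (f \o g) R R''.
Proof.
by move=> h h' a /h'[/h[h1 h2] h3]; split=> // /h3 /h2.
Qed.

Definition valuation_ring (K : fieldType) (O : set K) : Prop :=
  subring O /\ forall a, O a \/ O a^-1.

(** Valuation rings are maximal for domination: if a is in O but not in O', then a^-1 is in the
    maximal ideal of O', so f a^-1 is a non-unit of R although its inverse f a lies in R. *)
Lemma dominates_uniq (F K : fieldType) (f : {rmorphism K -> F}) (R : set F)
  (O O' : set K) :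
  valuation_ring O -> valuation_ring O' -> dominates f R O -> dominates f R O' ->
  O = O'.
Proof.
move: O O'; suff h O O' : valuation_ring O -> valuation_ring O' ->
    dominates f R O -> dominates f R O' -> O `<=` O'.
  by move=> O O' *; apply/seteqP; split; exact: h.
move=> [sO _] [_ vO'] dO dO' a Oa; apply: contrapT => O'a.
have [//|O'ai] := vO' a.
(* Since 0^-1 = 0, [O'ai] excludes a = 0. *)
have a0 : a != 0 by apply: contra_notN O'a => /eqP a0; rewrite a0 invr0 in O'ai *.
have [_ []] := dO' _ O'ai.
  by split=> //; right; rewrite invrK.
move=> _ [/eqP|]; first by rewrite fmorph_eq0 invr_eq0 (negPf a0).
by rewrite fmorphV invrK; apply; case: (dO _ Oa).
Qed.

Section ValuationRing.
Variables (K : fieldType) (O : set K).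
Hypothesis vO : valuation_ring O.

Lemma maxid0 : maxid O 0.
Proof. by split; [exact: subring0 vO.1|left]. Qed.

Lemma not_maxid a : O a -> ~ maxid O a -> a != 0 /\ O a^-1.
Proof.
move=> Oa ma; split; first by apply: contra_notN ma => /eqP ->; exact: maxid0.
by apply: contrapT => h; apply: ma; split=> //; right.
Qed.

Lemma unit_not_maxid a : a != 0 -> O a^-1 -> ~ maxid O a.
Proof. by move=> a0 Oai [_ [/eqP|//]]; rewrite (negPf a0). Qed.

Lemma maxidM a b : O a -> maxid O b -> maxid O (a * b).
Proof.
move=> Oa [Ob mb]; split; first exact: subringM vO.1 _ _.
have [->|b0] := eqVneq b 0; first by left; rewrite mulr0.
have [->|a0] := eqVneq a 0; first by left; rewrite mul0r.
right=> h; case: mb => [/eqP|]; first by rewrite (negPf b0).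
apply; have -> : b^-1 = a * (a * b)^-1 by rewrite invfM mulVKf.
exact: subringM vO.1 _ _.
Qed.

Lemma maxid_prime a b : O a -> O b -> maxid O (a * b) -> maxid O a \/ maxid O b.
Proof.
move=> Oa Ob [_ h]; apply: contrapT => /not_orP[/(not_maxid Oa)[a0 Oai] /(not_maxid Ob)[b0 Obi]].
case: h => [/eqP|]; first by rewrite mulf_eq0 (negPf a0) (negPf b0).
by apply; rewrite invfM; exact: subringM vO.1 _ _.
Qed.

Lemma maxidD a b : maxid O a -> maxid O b -> maxid O (a + b).
Proof.
move: a b; suff h a b : maxid O a -> maxid O b -> O (a / b) -> maxid O (a + b).
  move=> a b ma mb; case: (vO.2 (a / b)) => hab; first exact: h.
  by rewrite addrC; apply: h => //; rewrite -[b / a]invf_div.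
move=> ma mb hab; have [b0|b0] := eqVneq b 0; first by rewrite b0 addr0.
have -> : a + b = (a / b + 1) * b by rewrite mulrDl divfK // mul1r.
by apply: maxidM => //; apply: subringD vO.1 _ _ => //; exact: subring1 vO.1.
Qed.

Lemma maxid_notin1 : ~ maxid O 1.
Proof. by apply: unit_not_maxid; rewrite ?oner_neq0 // invr1; exact: subring1 vO.1. Qed.

End ValuationRing.

(* The graph of a place of F with values in K, trivial on K. *)
Record place_graph (K F : fieldType) (emb : {rmorphism K -> F})
    (Rs : F -> K -> Prop) : Prop := PlaceGraph {
  pg_fun : forall x a b, Rs x a -> Rs x b -> a = b;
  pg_emb : forall a, Rs (emb a) a;
  pg_sub : forall x y a b, Rs x a -> Rs y b -> Rs (x - y) (a - b);
  pg_mul : forall x y a b, Rs x a -> Rs y b -> Rs (x * y) (a * b);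
  pg_inv : forall x a, Rs x a -> a != 0 -> Rs x^-1 a^-1 }.

Section Composite.
Variables (K F : fieldType) (emb : {rmorphism K -> F}) (Rs : F -> K -> Prop).
Variables (O : set K) (A : set F).
Hypotheses (pg : place_graph emb Rs) (vO : valuation_ring O) (sA : subring A).
Hypothesis A_res : forall x, A x -> exists2 r, Rs x r & O r.
Hypothesis A_emb : forall a, O a -> A (emb a).

Lemma pg_add x y a b : Rs x a -> Rs y b -> Rs (x + y) (a + b).
Proof.
move=> xa yb; rewrite -[y]opprK -[b]opprK; apply: (pg_sub pg) => //.
rewrite -sub0r -[- b]sub0r; apply: (pg_sub pg) => //.
by rewrite -(rmorph0 emb); exact: (pg_emb pg).
Qed.

Lemma pg1 : Rs 1 1.
Proof. by rewrite -[X in Rs X](rmorph1 emb); exact: (pg_emb pg). Qed.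

Lemma pg_exp x a n : Rs x a -> Rs (x ^+ n) (a ^+ n).
Proof.
move=> xa; elim: n => [|n IH]; first exact: pg1.
by rewrite !exprS; exact: (pg_mul pg).
Qed.

Lemma pg_neq0 x a : Rs x a -> a != 0 -> x != 0.
Proof.
move=> xa; apply: contra_neq => x0; apply: (pg_fun pg xa).
by rewrite x0 -(rmorph0 emb); exact: (pg_emb pg).
Qed.

(** The ideal, in a chart [A] of a surface, of a point on the curve along which [Rs] evaluates.
    Localising [A] at it, instead of taking all x with value in [O], gives the local ring of that
    point. *)
Definition center : set F := [set x | A x /\ exists2 r, Rs x r & maxid O r].

Definition composite : set F := localize A center.

Lemma center_prime : prime_ideal A center.
Proof.
split.
- by move=> x [].
- split; first exact: subring0.
  exists 0; last exact: maxid0.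
  by rewrite -(rmorph0 emb); exact: (pg_emb pg).
- move=> x y [Ax [r xr mr]] [Ay [s ys ms]]; split; first exact: subringD.
  by exists (r + s); [exact: pg_add|exact: maxidD].
- move=> x y Ax [Ay [s ys ms]]; split; first exact: subringM.
  have [r xr Or] := A_res Ax.
  by exists (r * s); [exact: (pg_mul pg)|exact: maxidM].
split.
  move=> [_ [r /(pg_fun pg pg1) <-]]; exact: maxid_notin1.
move=> x y Ax Ay [_ [s xys ms]].
have [r xr Or] := A_res Ax; have [r' yr' Or'] := A_res Ay.
have e := pg_fun pg xys (pg_mul pg xr yr'); rewrite e in ms.
by have [m|m] := maxid_prime vO Or Or' ms; [left|right]; split=> //; [exists r|exists r'].
Qed.

Lemma center_emb a : O a -> (center (emb a) <-> maxid O a).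
Proof.
move=> Oa; split=> [[_ [r /(pg_fun pg (pg_emb pg a)) <-]]//|ma].
by split; [exact: A_emb|exists a => //; exact: (pg_emb pg)].
Qed.

Lemma composite_subring : subring composite.
Proof. exact: localize_subring center_prime. Qed.

Lemma sub_composite : A `<=` composite.
Proof. exact: sub_localize center_prime. Qed.

Lemma not_center x : A x -> ~ center x ->
  exists r, [/\ Rs x r, r != 0, O r & O r^-1].
Proof.
move=> Ax cx; have [r xr Or] := A_res Ax; exists r.
have [|r0 Ori] := not_maxid vO Or; last by split.
by move=> mr; apply: cx; split=> //; exists r.
Qed.

Lemma composite_res x : composite x -> exists2 r, Rs x r & O r.
Proof.
move=> [a [b [Aa Ab /(not_center Ab)[s [bs s0 Os Osi]] ->]]].
have [r ar Or] := A_res Aa; exists (r / s).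
  by apply: (pg_mul pg) => //; exact: (pg_inv pg).
exact: subringM vO.1 _ _.
Qed.

Lemma composite_inv x r : composite x -> Rs x r -> r != 0 -> O r^-1 -> composite x^-1.
Proof.
move=> [a [b [Aa Ab qb ->]]] xr r0 Ori.
have [s [bs s0 Os Osi]] := not_center Ab qb; have b0 := pg_neq0 bs s0.
have ars : Rs a (r * s) by rewrite -(divfK b0 a); exact: (pg_mul pg).
exists b, a; rewrite invf_div; split=> //.
move=> [_ [t /(pg_fun pg ars) <-]]; apply: unit_not_maxid.
  by rewrite mulf_neq0.
by rewrite invfM; exact: subringM vO.1 _ _.
Qed.

Lemma composite_maxid x r : composite x -> Rs x r -> maxid composite x <-> maxid O r.
Proof.
move=> Tx xr; have [r' xr' Or] := composite_res Tx.
have e := pg_fun pg xr' xr; rewrite e in Or; split.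
  move=> [_ h]; apply: contrapT => /(not_maxid vO Or)[r0 Ori].
  case: h => [x0|]; last by apply; exact: composite_inv Tx xr r0 Ori.
  by have := pg_neq0 xr r0; rewrite x0 eqxx.
move=> mr; split=> //; have [->|x0] := eqVneq x 0; [by left|right].
move=> /composite_res[s xs Os].
have /(pg_fun pg pg1) e1 : Rs 1 (r * s) by rewrite -(mulfV x0); exact: (pg_mul pg).
by apply: (maxid_notin1 vO); rewrite e1 mulrC; exact: maxidM.
Qed.

(** Lets an equation [t] of the curve on the chart serve as an equation in the local ring:
    denominators have nonzero value, so a fraction of value 0 has a numerator of value 0. *)
Lemma composite_ker t x : (forall y, A y -> Rs y 0 -> exists2 z, A z & y = t * z) ->
  composite x -> Rs x 0 -> exists2 z, composite z & x = t * z.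
Proof.
move=> h [a [b [Aa Ab qb ->]]] x0.
have [s [bs s0 Os Osi]] := not_center Ab qb; have b0 := pg_neq0 bs s0.
have [|z Az ->] := h _ Aa.
  by rewrite -(divfK b0 a) -(mul0r s); exact: (pg_mul pg).
by exists (z / b); [exists z, b|rewrite mulrA].
Qed.

Lemma composite_dominates : dominates emb composite O.
Proof.
apply: localize_dominates => //; first exact: center_prime.
by move=> a Oa /(center_emb Oa).
Qed.

End Composite.

End Domination.

(** * The projective bundle along the section at infinity *)

Section Stalks.
Local Open Scope classical_set_scope.
Local Open Scope ring_scope.
Context {k : closedFieldType} {K : fieldType} {iota : {rmorphism k -> K}}.
Implicit Types (c : point iota) (D : place iota -> int).

Lemma stalkC_valuation c : valuation_ring (stalkC c).
Proof.
case: c => [v|]; last by split=> //; left.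
split; [split|] => /=.
- by right; rewrite ord1.
- by rewrite oppr0 => x y hx hy; apply: ord_geD => //; exact: ord_geN.
- by rewrite oppr0 => x y hx hy; rewrite -(addr0 0); exact: ord_geM.
- move=> x; rewrite oppr0; have [h|h] := lerP 0 (ord v x); first by left; right.
  by right; right; rewrite ordV oppr_ge0 ltW.
Qed.

Lemma OC_prin D c d : d != 0 -> (forall v, c = Some v -> ord v d = - D v) ->
  OC D c = prin (stalkC c) d.
Proof.
move=> d0; case: c => [v|] hd; apply/seteqP; split=> x.
- move=> hx; apply/prinE => //=; have {}hd := hd v erefl.
  rewrite (_ : - 0 = - D v + D v); last by rewrite addNr oppr0.
  by apply: ord_geM => //; right; rewrite ordV hd opprK.
- move=> [y /= hy <-]; rewrite -[- D v]addr0; apply: ord_geM; last by rewrite -oppr0.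
  by right; rewrite hd.
- by move=> _; apply/prinE.
- by [].
Qed.

Lemma divisor_generator D c : exists2 d : K, d != 0 &
  forall v, c = Some v -> ord v d = - D v.
Proof.
case: c => [v|]; last by exists 1 => //; exact: oner_neq0.
have [t vt] := ord_unif v; exists (t ^ (- D v)).
  by rewrite expfz_neq0 //; apply/eqP => t0; move: vt; rewrite t0 ord0.
by move=> _ [<-]; rewrite ordXz vt mulr1.
Qed.

Lemma stalkC_inj c c' : stalkC c = stalkC c' -> c = c'.
Proof.
have aux (v : place iota) : stalkC (None : point iota) <> stalkC (Some v).
  have [t vt] := ord_unif v; have t0 : t != 0.
    by apply/eqP => t0; move: vt; rewrite t0 ord0.
  move=> h; have : stalkC (Some v) t^-1 by rewrite -h.
  rewrite /= oppr0 => /ord_geE; rewrite ?invr_eq0 => /(_ t0).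
  by rewrite ordV vt.
case: c c' => [v|] [w|] // h; last 2 first.
- by have := aux v; rewrite h.
- by have := aux w; rewrite h.
congr Some; apply: place_sub => x vx.
have [->|x0] := eqVneq x 0; first by rewrite ord0.
have : stalkC (Some w) x by rewrite -h /=; right; rewrite oppr0.
by rewrite /= oppr0 => /ord_geE; exact.
Qed.

Section Emb.
Variables (F : fieldType) (emb : {rmorphism K -> F}).

Lemma lies_over_uniq R c c' : lies_over emb R c -> lies_over emb R c' -> c = c'.
Proof.
move=> h h'; apply: stalkC_inj; apply: dominates_uniq h h'; exact: stalkC_valuation.
Qed.

(** The existential over c in [pull_gen] has at most one witness, since a local ring dominates at
    most one stalk. *)
Lemma pull_genE (T : Type) (f : T -> F) (L : point iota -> set T) R c :
  lies_over emb R c -> pull_gen emb f L R = span R (f @` L c).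
Proof.
move=> h; apply/seteqP; split=> [x [c' h' hx]|x hx]; last by exists c.
by rewrite (lies_over_uniq h h').
Qed.

Lemma pullC_prin (L : point iota -> set K) R c d : subring R ->
  lies_over emb R c -> L c = prin (stalkC c) d -> pullC emb L R = prin R (emb d).
Proof.
move=> sR h Ld; rewrite /pullC (pull_genE _ _ h); apply: span_prin => //.
  exists d => //; rewrite Ld; exists 1; rewrite ?mulr1 //.
  exact: subring1 (stalkC_valuation c).1.
move=> _ [x + <-]; rewrite Ld => -[y Oy <-]; rewrite rmorphM.
by exists (emb y) => //; case: (h _ Oy).
Qed.

End Emb.
End Stalks.

HB.instance Definition _ (K : fieldType) :=
  GRing.RMorphism.copy (@embP K) (@FracField.tofrac {poly K} \o polyC).

(** * The place z = oo of K(z) *)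

Section Infinity.
Local Open Scope classical_set_scope.
Local Open Scope ring_scope.
Context {K : fieldType}.
Local Notation tofrac := (@FracField.tofrac {poly K}).
Implicit Types (n d : {poly K}) (x y : KP K).

Lemma coefM_top n d i j : (size n <= i.+1)%N -> (size d <= j.+1)%N ->
  (n * d)`_(i + j) = n`_i * d`_j.
Proof.
move=> ni dj; rewrite coefM.
have hi : (i < (i + j).+1)%N by rewrite ltnS leq_addr.
rewrite (bigD1 (Ordinal hi)) //= addKn big1 ?addr0 // => m mi.
have [lmi|lim|emi] := ltngtP m i.
- rewrite [d`__]nth_default ?mulr0 //; apply: leq_trans dj _.
  by rewrite ltn_subRL; lia.
- by rewrite [n`__]nth_default ?mul0r //; apply: leq_trans ni _.
- by move: mi; rewrite -(inj_eq val_inj) /= emi eqxx.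
Qed.

(* The value of x at z = oo. *)
Definition res_inf x (r : K) : Prop :=
  exists n d, [/\ d != 0, (size n <= size d)%N, x = tofrac n / tofrac d &
                  r = n`_(size d).-1 / lead_coef d].

(** The value is the ratio of the coefficients in degree deg d. It is multiplicative by [coefM_top],
    and independent of the fraction by comparing top coefficients after cross-multiplication. *)
Lemma res_inf_graph : place_graph (@embP K) res_inf.
Proof.
have T0 d : d != 0 -> tofrac d != 0 by rewrite tofrac_eq0.
have sz d : d != 0 -> size d = (size d).-1.+1.
  by move=> d0; rewrite prednK // size_poly_gt0.
have sM n d : n != 0 -> d != 0 -> size (n * d) = ((size n).-1 + (size d).-1).+1.
  by move=> n0 d0; rewrite size_mul // (sz n n0) (sz d d0) /= addnS.
have arith i j i' j' : (i <= j)%N -> (i' <= j')%N -> j = j.-1.+1 -> j' = j'.-1.+1 ->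
    ((i + i').-1 <= (j.-1 + j'.-1).+1)%N by lia.
have l0 d : d != 0 -> lead_coef d != 0 by rewrite lead_coef_eq0.
split.
- move=> x a b [n [d [d0 nd -> ->]]] [n' [d' [d'0 nd' /eqP]]].
  rewrite eqr_div ?T0 // -!tofracM tofrac_eq => /eqP e ->.
  apply/eqP; rewrite eqr_div ?l0 //; apply/eqP.
  rewrite !lead_coefE -!coefM_top -?sz //.
  by rewrite e addnC.
- move=> a; exists a%:P, 1; rewrite oner_neq0 size_poly1 tofrac1 divr1 lead_coef1 divr1.
  by split; rewrite ?coefC //; exact: size_polyC_leq1.
- move=> x y a b [n [d [d0 nd -> ->]]] [n' [d' [d'0 nd' -> ->]]].
  exists (n * d' - n' * d), (d * d'); split.
  + by rewrite mulf_neq0.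
  + rewrite sM //; apply: leq_trans (size_polyD _ _) _; rewrite size_polyN geq_max.
    apply/andP; split; apply: leq_trans (size_polyMleq _ _) _.
      exact: arith nd (leqnn _) (sz d d0) (sz d' d'0).
    by rewrite addnC; exact: arith (leqnn _) nd' (sz d d0) (sz d' d'0).
  + by rewrite tofracB !tofracM -mulNr addf_div ?T0 // mulNr.
  + rewrite sM //= coefB lead_coefM coefM_top -?sz //.
    rewrite [((size d).-1 + _)%N]addnC coefM_top -?sz // -!lead_coefE.
    by rewrite -mulNr addf_div ?l0 // mulNr.
- move=> x y a b [n [d [d0 nd -> ->]]] [n' [d' [d'0 nd' -> ->]]].
  exists (n * n'), (d * d'); split.
  + by rewrite mulf_neq0.
  + rewrite [leqRHS]sM //; apply: leq_trans (size_polyMleq _ _) _.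
    exact: arith nd nd' (sz d d0) (sz d' d'0).
  + by rewrite !tofracM mulf_div.
  + by rewrite sM //= coefM_top -?sz // lead_coefM mulf_div.
- move=> x a [n [d [d0 nd -> ->]]] h.
  have nl : n`_(size d).-1 != 0 by apply: contra_neq h => ->; rewrite mul0r.
  have sn : size n = size d.
    apply/eqP; rewrite eqn_leq nd /= leqNgt; apply/negP => lt.
    by move: nl; rewrite nth_default ?eqxx // -ltnS -sz.
  have n0 : n != 0 by apply: contra_neq nl => ->; rewrite coef0.
  exists d, n; split; rewrite ?sn ?invf_div //.
  by rewrite /lead_coef sn.
Qed.

Lemma linE (s : K * K) : lin s = tofrac (s.1%:P + s.2%:P * 'X).
Proof. by rewrite /lin /embP /zP tofracD tofracM. Qed.

Lemma lin_eq0 (s : K * K) : (lin s == 0) = (s == 0).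
Proof.
rewrite linE tofrac_eq0; case: s => a b /=; apply/eqP/eqP => [h|[-> ->]].
  have := congr1 (fun q : {poly K} => q`_0) h; have := congr1 (fun q : {poly K} => q`_1) h.
  by rewrite /= !coefD !coefMX !coefC /= addr0 add0r => -> ->.
by rewrite mul0r addr0.
Qed.

Lemma linD (s s' : K * K) : lin (s + s') = lin s + lin s'.
Proof. by rewrite /lin /= !rmorphD mulrDl addrACA. Qed.

Lemma linZ a (s : K * K) : lin (a * s.1, a * s.2) = embP a * lin s.
Proof. by rewrite /lin /= !rmorphM mulrDr mulrA. Qed.

Lemma lin10 : lin (1, 0) = 1 :> KP K.
Proof. by rewrite /lin /= rmorph1 rmorph0 mul0r addr0. Qed.

(** On E, where e_0 vanishes, a section of O(1) restricts to its image in L, which is the second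
    coordinate. *)
Lemma res_lin (s s' : K * K) : s.2 != 0 -> res_inf (lin s' / lin s) (s'.2 / s.2).
Proof.
move=> s2; rewrite !linE; exists (s'.1%:P + s'.2%:P * 'X), (s.1%:P + s.2%:P * 'X).
have sz : size (s.1%:P + s.2%:P * 'X) = 2%N.
  by rewrite addrC size_MXaddC polyC_eq0 (negPf s2) size_polyC s2.
split=> //; first by rewrite -size_poly_eq0 sz.
  by rewrite sz addrC size_MXaddC; case: ifP => // _; rewrite ltnS size_polyC_leq1.
by rewrite lead_coefE sz /= !coefD !coefMX !coefC /= !add0r.
Qed.

End Infinity.

Lemma addr_mulf_div (F : fieldType) (e x y a b : F) : (y != 0 -> b != 0 ->
  e + x / y * (a / b) = (e * (y * b) + x * a) / (y * b))%R.
Proof. by move=> y0 b0; rewrite mulrDl mulfK ?mulf_neq0 // mulf_div. Qed.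

Lemma divf_mul2r (F : fieldType) (x y u : F) : (u != 0 ->
  x / y = (x * u) / (y * u))%R.
Proof. by move=> u0; rewrite -mulf_div divff // mulr1. Qed.

Lemma divf_cross (F : fieldType) (a b c d : F) : (b != 0 -> c != 0 ->
  a / b / (c / d) * (c * b) = a * d)%R.
Proof.
move=> b0 c0; rewrite invf_div mulf_div -mulrA [(b * c)%R]mulrC mulVf ?mulr1 //.
by rewrite mulf_neq0.
Qed.

Section SectionPoint.
Local Open Scope classical_set_scope.
Local Open Scope ring_scope.
Context {K : fieldType}.
Variables (O : set K) (d h : K).
Hypotheses (vO : valuation_ring O) (d0 : d != 0).

(** The lattice with basis e_0 and d (h e_0 + e_1), the latter lifting the generator d of L. *)
Definition frame : set (K * K) :=
  [set s | exists al be, [/\ O al, O be & s = (al + be * (d * h), be * d)]].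

(* The coordinate vanishing on the section e_0 = 0. *)
Definition coord : KP K := (lin (d * h, d))^-1.

Definition chart_inf : set (KP K) := subring_gen (@embP K @` O `|` [set coord]).

Definition point_inf : set (KP K) := composite (@res_inf K) O chart_inf.

Let pg := @res_inf_graph K.

Lemma frame10 : frame (1, 0).
Proof.
exists 1, 0; rewrite !mul0r addr0; split=> //; first exact: subring1 vO.1.
exact: subring0 vO.1.
Qed.

Lemma frame_dh : frame (d * h, d).
Proof.
exists 0, 1; rewrite !mul1r add0r; split=> //; first exact: subring0 vO.1.
exact: subring1 vO.1.
Qed.

Lemma lin_dh_neq0 : lin (d * h, d) != 0.
Proof. by rewrite lin_eq0; apply: contra_neq d0 => -[]. Qed.

Lemma coord_neq0 : coord != 0.
Proof. by rewrite invr_eq0 lin_dh_neq0. Qed.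

Lemma res_coord : res_inf coord 0.
Proof.
by have := @res_lin _ (d * h, d) (1, 0) d0; rewrite lin10 mul1r /= mul0r.
Qed.

Lemma chart_inf_subring : subring chart_inf.
Proof. exact: subring_gen_subring. Qed.

Lemma chart_inf_emb a : O a -> chart_inf (embP a).
Proof. by move=> Oa; apply: subset_gen; left; exists a. Qed.

Lemma chart_inf_coord : chart_inf coord.
Proof. by apply: subset_gen; right. Qed.

(** [chart_inf] is O[u] with u = [coord]. The decomposition splits off the constant term, which is
    the value because u vanishes at z = oo. Elements of this form make up a subring containing the
    generators, and this is the induction principle of [subring_gen]. *)
Lemma chart_inf_dec x : chart_inf x ->
  exists a y, [/\ O a, chart_inf y, x = embP a + coord * y & res_inf x a].
Proof.
move=> hx; suff [a [y [Oa Ay e]]] : exists a y, [/\ O a, chart_inf y & x = embP a + coord * y].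
  exists a, y; split=> //; rewrite e -[X in res_inf _ X]addr0.
  suff [r yr] : exists r, res_inf y r.
    rewrite -(mul0r r).
    exact: pg_add pg _ _ _ _ (pg_emb pg a) (pg_mul pg res_coord yr).
  apply: (Ay [set y | exists r, res_inf y r]).
    split; first by exists 1; exact: pg1 pg.
      by move=> z w [r zr] [s ws]; exists (r - s); exact: (pg_sub pg).
    by move=> z w [r zr] [s ws]; exists (r * s); exact: (pg_mul pg).
  by move=> _ [[b _ <-]|->]; [exists b; exact: (pg_emb pg)|exists 0; exact: res_coord].
apply: (hx [set x | exists a y, [/\ O a, chart_inf y & x = embP a + coord * y]]).
  have sA := chart_inf_subring; split.
  - exists 1, 0; rewrite rmorph1 mulr0 addr0; split=> //; first exact: subring1 vO.1.
    exact: (subring0 sA).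
  - move=> _ _ [a [y [Oa Ay ->]]] [b [z [Ob Az ->]]].
    exists (a - b), (y - z); rewrite rmorphB mulrBr; split.
    + exact: subringB vO.1 _ _.
    + exact: (subringB sA).
    + by rewrite opprD addrACA.
  - move=> _ _ [a [y [Oa Ay ->]]] [b [z [Ob Az ->]]].
    exists (a * b), (y * embP b + embP a * z + coord * y * z); split.
    + exact: subringM vO.1 _ _.
    + have [[Ea Eb] Eu] := (chart_inf_emb Oa, chart_inf_emb Ob, chart_inf_coord).
      have M v w : chart_inf v -> chart_inf w -> chart_inf (v * w) := subringM sA.
      exact: subringD sA (subringD sA (M _ _ Ay Eb) (M _ _ Ea Az)) (M _ _ (M _ _ Eu Ay) Az).
    + by rewrite rmorphM /=; move: coord (embP a) (embP b) => u A B; ring.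
move=> _ [[a Oa <-]|->].
  by exists a, 0; rewrite mulr0 addr0; split=> //; exact: subring0 chart_inf_subring.
exists 0, 1; rewrite rmorph0 mulr1 add0r; split=> //; first exact: subring0 vO.1.
exact: subring1 chart_inf_subring.
Qed.

Lemma chart_inf_res x : chart_inf x -> exists2 r, res_inf x r & O r.
Proof. by move=> /chart_inf_dec[a [y [Oa _ _ ?]]]; exists a. Qed.

Lemma chart_inf_ker x : chart_inf x -> res_inf x 0 ->
  exists2 y, chart_inf y & x = coord * y.
Proof.
move=> /chart_inf_dec[a [y [_ Ay e xa]]] x0; exists y => //.
by rewrite e (pg_fun pg xa x0) rmorph0 add0r.
Qed.

Lemma point_inf_subring : subring point_inf.
Proof.
exact: composite_subring pg vO chart_inf_subring chart_inf_res.
Qed.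

Lemma sub_point_inf : chart_inf `<=` point_inf.
Proof. exact: sub_composite pg vO chart_inf_subring chart_inf_res. Qed.

Lemma point_inf_emb a : O a -> point_inf (embP a).
Proof. by move=> /chart_inf_emb; exact: sub_point_inf. Qed.

Lemma point_inf_coord : point_inf coord.
Proof. by apply: sub_point_inf; exact: chart_inf_coord. Qed.

Lemma point_inf_res x : point_inf x -> exists2 r, res_inf x r & O r.
Proof. exact: composite_res pg vO chart_inf_res _. Qed.

Lemma point_inf_inv x r : point_inf x -> res_inf x r -> r != 0 -> O r^-1 ->
  point_inf x^-1.
Proof. exact: composite_inv pg vO chart_inf_res _ _. Qed.

Lemma point_inf_maxid x r : point_inf x -> res_inf x r ->
  maxid point_inf x <-> maxid O r.
Proof. exact: composite_maxid pg vO chart_inf_res _ _. Qed.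

Lemma point_inf_ker x : point_inf x -> res_inf x 0 ->
  exists2 y, point_inf y & x = coord * y.
Proof. exact: (composite_ker pg vO chart_inf_res chart_inf_ker). Qed.

Lemma point_inf_dominates : dominates (@embP K) point_inf O.
Proof.
exact: (composite_dominates pg vO chart_inf_subring chart_inf_res chart_inf_emb).
Qed.

Lemma lin_frame al be :
  lin (al + be * (d * h), be * d) = embP al + embP be * lin (d * h, d).
Proof.
rewrite -(mulr1 (embP al)) -lin10 -!linZ -linD /=.
by rewrite mulr1 mulr0; congr lin; congr pair; rewrite ?add0r.
Qed.

Lemma lin_frame_coord s : frame s ->
  exists al be, [/\ O al, O be, s = (al + be * (d * h), be * d) &
    lin s * coord = embP be + embP al * coord].
Proof.
move=> [al [be [Oal Obe ->]]]; exists al, be; split=> //.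
by rewrite lin_frame mulrDl addrC mulfK // lin_dh_neq0.
Qed.

End SectionPoint.

Section ProjE.
Local Open Scope classical_set_scope.
Local Open Scope ring_scope.
Context {k : closedFieldType} {K : fieldType} {iota : {rmorphism k -> K}}.
Variable E : point iota -> set (K * K).
Implicit Type c : point iota.

Let pg := @res_inf_graph K.

Lemma chart_subring c s : subring (chart E c s).
Proof. exact: subring_gen_subring. Qed.

Lemma chart_emb c s a : stalkC c a -> chart E c s (embP a).
Proof. by move=> ca; apply: subset_gen; left; exists a. Qed.

Lemma chart_lin c s s' : E c s' -> chart E c s (lin s' / lin s).
Proof. by move=> Es'; apply: subset_gen; right; exists s'. Qed.

Lemma projE_subring R : projE E R -> subring R.
Proof.
move=> [c [s [q [_ _ qP _ ->]]]]; apply: localize_subring qP; exact: chart_subring.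
Qed.

Lemma projE_lies_over R c s q : prime_ideal (chart E c s) q ->
  (forall a, stalkC c a -> (q (embP a) <-> maxid (stalkC c) a)) ->
  R = localize (chart E c s) q -> lies_over (@embP K) R c.
Proof.
move=> qP qc ->; apply: localize_dominates => //; first exact: chart_subring.
  exact: chart_emb.
by move=> a ca /(proj2 (qc _ ca)).
Qed.

Lemma projE_over R : projE E R -> exists c, lies_over (@embP K) R c.
Proof. by move=> [c [s [q [_ _ qP qc Re]]]]; exists c; exact: projE_lies_over qc Re. Qed.

Lemma O1_chart c s q : E c s -> s != 0 -> prime_ideal (chart E c s) q ->
  (forall a, stalkC c a -> (q (embP a) <-> maxid (stalkC c) a)) ->
  O1 E (localize (chart E c s) q) = prin (localize (chart E c s) q) (lin s).
Proof.
move=> Es s0 qP qc; have sR := localize_subring (chart_subring c s) qP.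
rewrite /O1 (pull_genE _ _ (projE_lies_over qP qc erefl)); apply: span_prin => //.
move=> _ [s' Es' <-]; apply/prinE; first by rewrite lin_eq0.
apply: sub_localize qP _ _; first exact: chart_subring.
exact: chart_lin.
Qed.

Section At.
Variables (c : point iota) (d h : K).
Hypotheses (d0 : d != 0) (Ec : E c = frame (stalkC c) d h).

Let O := stalkC c.
Let vO : valuation_ring O := stalkC_valuation c.

Lemma chart_infE : chart E c (d * h, d) = chart_inf O d h.
Proof.
apply/seteqP; split=> x hx A sA BA; apply: hx => //.
  move=> _ [[a Oa <-]|[s' + <-]]; first by apply: BA; left; exists a.
  rewrite Ec => /(lin_frame_coord d0)[al [be [Oal Obe -> ->]]].
  apply: subringD => //; first by apply: BA; left; exists be.
  apply: subringM => //; apply: BA; last by right.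
  by left; exists al.
move=> _ [[a Oa <-]|->]; first by apply: BA; left; exists a.
apply: BA; right; exists (1, 0); first by rewrite Ec; exact: frame10.
by rewrite lin10 mul1r.
Qed.

Lemma projE_point_inf : projE E (point_inf O d h).
Proof.
exists c, (d * h, d), (center (@res_inf K) O (chart_inf O d h)).
have sA := @chart_inf_subring _ O d h.
have Ar : forall x, chart_inf O d h x -> exists2 r, res_inf x r & O r.
  by move=> x; exact: chart_inf_res.
rewrite chart_infE; split=> //.
- by rewrite Ec; exact: frame_dh.
- by apply: contra_neq d0 => -[].
- exact: center_prime pg vO sA Ar.
- exact: center_emb pg (@chart_inf_emb _ O d h).
Qed.

Lemma O1_point_inf : O1 E (point_inf O d h) = prin (point_inf O d h) (lin (d * h, d)).
Proof.
have sA := @chart_inf_subring _ O d h.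
have Ar : forall x, chart_inf O d h x -> exists2 r, res_inf x r & O r.
  by move=> x; exact: chart_inf_res.
have := @O1_chart c (d * h, d) (center (@res_inf K) O (chart_inf O d h)).
rewrite chart_infE; apply.
- by rewrite Ec; exact: frame_dh.
- by apply: contra_neq d0 => -[].
- exact: center_prime pg vO sA Ar.
- exact: center_emb pg (@chart_inf_emb _ O d h).
Qed.

(* The section e_0 = 0 has only one point over c. *)
Lemma projE_uniq R : projE E R -> lies_over (@embP K) R c ->
  ~ dual (O1 E) R 1 -> R = point_inf O d h.
Proof.
move=> [c' [s [q [Es s0 qP qc Re]]]] Rc.
have Rc' := projE_lies_over qP qc Re.
move: (lies_over_uniq Rc' Rc) Es qP qc Re => -> Es qP qc Re {c' Rc'}.
have sC := chart_subring c s; have sR : subring R.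
  by rewrite Re; exact: localize_subring qP.
have CR : chart E c s `<=` R by rewrite Re; exact: sub_localize qP.
have invR z : chart E c s z -> ~ q z -> R z^-1 by rewrite Re; exact: localize_inv.
have qD y z : q y -> q z -> q (y + z) by case: (qP) => _ _ + _ _; apply.
have qM y z : chart E c s y -> q z -> q (y * z) by case: (qP) => _ _ _ + _; apply.
have qM' y z : q y -> chart E c s z -> q (y * z) by rewrite mulrC => *; exact: qM.
have qB y z : q (y + z) -> q z -> q y.
  move=> h1 h2; rewrite -(addrK z y) -mulrN1; apply: (qD) => //.
  by apply: qM' => //; apply: (subringN sC); exact: (subring1 sC).
(* The dual of O(1) is generated by 1 / [lin s], so the hypothesis says that [lin s] is not in R;
   then x = e_0 / s is a non-unit and belongs to q. *)
rewrite (dual_prin (x := lin s)) ?lin_eq0 //; last first.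
  by rewrite Re; exact: O1_chart.
move=> Rs; have {}Rs : ~ R (lin s).
  by move=> h1; apply: Rs; apply/prinE; rewrite ?invr_eq0 ?lin_eq0 // invrK mul1r.
have ls0 : lin s != 0 by rewrite lin_eq0.
pose x := (lin s)^-1.
have Cx : chart E c s x.
  by rewrite /x -[_^-1]mul1r -lin10; apply: chart_lin; rewrite Ec; exact: frame10.
have qx : q x by apply: contrapT => /(invR _ Cx); rewrite invrK.
pose y := lin (d * h, d) / lin s.
have Cy : chart E c s y by apply: chart_lin; rewrite Ec; exact: frame_dh.
have [al [be [Oal Obe es lsc]]] : exists al be, [/\ O al, O be,
    s = (al + be * (d * h), be * d) &
    lin s * coord d h = embP be + embP al * coord d h].
  by apply: lin_frame_coord => //; rewrite -Ec.
(* This is s / s = 1 in the basis of the frame. As x is in q, neither [be] nor y is; so y is a unit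
   and u = x / y lies in R. *)
have one : embP al * x + embP be * y = 1.
  by rewrite mulrA -mulrDl -(lin_frame d h al be) -es mulfV.
have q1 := prime_notin1 qP.
have ube : ~ maxid O be.
  move=> /(qc _ Obe) qbe; apply: q1; rewrite -one; apply: qD; last exact: qM'.
  by apply: qM => //; exact: chart_emb.
have [be0 Obei] := not_maxid vO Obe ube.
have qy : ~ q y.
  by move=> qy; apply: q1; rewrite -one; apply: qD; apply: qM => //; exact: chart_emb.
have y0 := prime_neq0 qP qy.
have ue : coord d h = x / y by rewrite /coord /y invf_div /x mulrA mulVf // mul1r.
(* Elements of O[u] become fractions over the given chart, and q matches the centre at infinity: the
   constant term decides both memberships. *)
have fraction w : chart_inf O d h w -> exists num den, [/\ chart E c s num,
    chart E c s den, ~ q den, w = num / den & forall r, res_inf w r -> (maxid O r <-> q num)].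
  have AR : chart_inf O d h `<=` R.
    move=> x1; apply; first exact: sR.
    move=> _ [[a Oa <-]|->]; first by apply: CR; exact: chart_emb.
    by rewrite ue; apply: subringM => //; [exact: CR|exact: invR].
  move=> /(chart_inf_dec vO d0)[e [w' [Oe /AR Rw' we wr]]].
  move: Rw'; rewrite {1}Re => -[a1 [b1 [Ca1 Cb1 qb1 w'e]]].
  have b10 := prime_neq0 qP qb1.
  have Ce : chart E c s (embP e) by exact: chart_emb.
  exists (embP e * (y * b1) + x * a1), (y * b1); split.
  - by apply: (subringD sC); apply: (subringM sC) => //; exact: (subringM sC).
  - exact: (subringM sC).
  - exact: primeM qP _ _ qy qb1.
  - by rewrite we w'e ue; exact: addr_mulf_div.
  move=> r /(pg_fun pg wr) <-; rewrite -(qc _ Oe); split=> [qe|].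
    by apply: qD; apply: qM' => //; exact: (subringM sC).
  move/qB/(_ (qM' _ _ qx Ca1)) => qn; apply: contrapT => qe; move: qn.
  by apply: (primeM qP) => //; [exact: (subringM sC)|exact: (primeM qP)].
(* Conversely, dividing by s amounts to inverting [lin s * coord] = be + al u, whose value [be] is a
   unit of O. *)
have Cinf : chart E c s `<=` point_inf O d h.
  have sP : subring (point_inf O d h) by exact: point_inf_subring.
  move=> w; apply; first exact: sP.
  move=> _ [[a Oa <-]|[s' + <-]]; first exact: point_inf_emb.
  rewrite Ec => /(lin_frame_coord d0)[al' [be' [Oal' Obe' _ e']]].
  have -> : lin s' / lin s = (lin s' * coord d h) / (lin s * coord d h).
    by apply: divf_mul2r; exact: coord_neq0.
  rewrite e' lsc; have Pu : point_inf O d h (coord d h) by exact: point_inf_coord.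
  have PD a b : O a -> O b -> point_inf O d h (embP a + embP b * coord d h).
    move=> Oa Ob; apply: (subringD sP); first exact: point_inf_emb.
    by apply: (subringM sP) => //; exact: point_inf_emb.
  apply: (subringM sP); first exact: PD.
  apply: (point_inf_inv vO d0 (r := be)) => //; first exact: PD.
  rewrite -[X in res_inf _ X]addr0 -(mulr0 al).
  apply: (pg_add pg); first exact: (pg_emb pg).
  by apply: (pg_mul pg); [exact: (pg_emb pg)|exact: res_coord].
apply/seteqP; split=> z.
  rewrite Re => -[a [b [Ca Cb qb ->]]].
  have [sP Pa Pb] : [/\ subring (point_inf O d h), point_inf O d h a & point_inf O d h b].
    by split; [exact: point_inf_subring|exact: Cinf|exact: Cinf].
  apply: (subringM sP) => //.
  have [r br Or] := point_inf_res vO d0 Pb.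
  have [mr|/(not_maxid vO Or)[r0 Ori]] := pselect (maxid O r); last first.
    exact: point_inf_inv br r0 Ori.
  (* If the value of b lay in the maximal ideal, clearing denominators in b = a' / b' would put the
     product of b with two elements outside q into q, hence b itself. *)
  case: qb; move: Pb => [a' [b' [Aa' Ab' cb' be']]].
  have [r' [b'r' r'0 Or' Or'i]] := not_center vO (fun x => @chart_inf_res _ O d h vO d0 x) Ab' cb'.
  have [num [den [Cn Cd qd a'e a'm]]] := fraction _ Aa'.
  have [num' [den' [Cn' Cd' qd' b'e b'm]]] := fraction _ Ab'.
  have qn : q num.
    apply/(a'm (r * r')); last by rewrite mulrC; exact: maxidM.
    have -> : a' = b * b' by rewrite be'; exact: esym (divfK (pg_neq0 pg b'r' r'0) a').
    exact: (pg_mul pg br b'r').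
  have qn' : ~ q num' by move=> /(b'm _ b'r'); exact: unit_not_maxid.
  have : q (b * (num' * den)).
    rewrite be' a'e b'e.
    rewrite (divf_cross _ _ (prime_neq0 qP qd) (prime_neq0 qP qn')).
    exact: qM'.
  case: (qP) => _ _ _ _ [_ hq] /(hq _ _ Cb (subringM sC Cn' Cd))[//|].
  by case/(hq _ _ Cn' Cd).
move=> [a [b [Aa Ab cb ->]]].
have [r [br r0 Or Ori]] := not_center vO (fun x => @chart_inf_res _ O d h vO d0 x) Ab cb.
have [num [den [Cn Cd qd -> _]]] := fraction _ Aa.
have [num' [den' [Cn' Cd' qd' be' b'm]]] := fraction _ Ab.
have qn' : ~ q num' by move=> /(b'm _ br); exact: unit_not_maxid.
rewrite be' invf_div; do 2?apply: (subringM sR) => //; by [exact: CR|exact: invR].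
Qed.

End At.
End ProjE.

(** * The relative Frobenius *)

Lemma eq_divf (F : fieldType) (a b c d : F) : (b != 0 -> d != 0 ->
  a / b = c / d <-> a * d = c * b)%R.
Proof.
move=> b0 d0; split=> [/eqP|/eqP]; first by rewrite eqr_div // => /eqP.
by rewrite -eqr_div // => /eqP.
Qed.

Section Frobenius.
Local Open Scope classical_set_scope.
Local Open Scope ring_scope.
Context {K : fieldType}.
Variable p : nat.
Hypothesis hp : p \in [pchar K].
Local Notation tofrac := (@FracField.tofrac {poly K}).
Local Notation rf := (@rel_frob K p).
Let pg := @res_inf_graph K.

Let p_gt0 : (0 < p)%N.
Proof. exact: prime_gt0 (pcharf_prime hp). Qed.

Lemma comp_polyXn_eq0 (d : {poly K}) : (d \Po 'X^p == 0) = (d == 0).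
Proof.
apply/eqP/eqP => [e|->]; last by rewrite comp_poly0.
apply/polyP => i; have := congr1 (fun q : {poly K} => q`_(i * p)) e.
by rewrite /= coef_comp_poly_Xn // dvdn_mull // mulnK // !coef0.
Qed.

(** [rel_frob] is defined on a chosen representative; cross-multiplication shows that any fraction
    may be used, which makes it a ring morphism. *)
Lemma rel_frobE (n d : {poly K}) : d != 0 ->
  rf (tofrac n / tofrac d) = tofrac (n \Po 'X^p) / tofrac (d \Po 'X^p).
Proof.
move=> d0; set x := tofrac n / tofrac d.
have h : tofrac (frac (repr x)).1 / tofrac (frac (repr x)).2 = tofrac n / tofrac d.
  by rewrite -tofrac_repr.
have := denom_ratioP (repr x); rewrite /rel_frob.
move: (frac (repr x)).1 (frac (repr x)).2 h => n' d' h d'0.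
have T0 (q : {poly K}) : q != 0 -> tofrac q != 0 by rewrite tofrac_eq0.
move: h => /(eq_divf _ _ (T0 _ d'0) (T0 _ d0)) /eqP.
rewrite -!tofracM tofrac_eq => /eqP e.
apply/eq_divf; rewrite ?T0 ?comp_polyXn_eq0 //.
by rewrite -!tofracM -!comp_polyM e.
Qed.

Lemma rel_frob_poly (n : {poly K}) : rf (tofrac n) = tofrac (n \Po 'X^p).
Proof.
have := @rel_frobE n 1 (oner_neq0 _).
by rewrite tofrac1 divr1 comp_polyC polyC1 tofrac1 divr1.
Qed.

Lemma rel_frob_embP a : rf (embP a) = embP a.
Proof. by rewrite rel_frob_poly comp_polyC. Qed.

Lemma rel_frobB x y : rf (x - y) = rf x - rf y.
Proof.
have [n [d [d0 ->]]] := tofrac_surj x; have [n' [d' [d'0 ->]]] := tofrac_surj y.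
rewrite -mulNr -tofracN addf_div ?tofrac_eq0 // -!tofracM -tofracD.
rewrite !rel_frobE ?mulf_neq0 // comp_polyD !comp_polyM -mulNr -tofracN.
rewrite addf_div ?tofrac_eq0 ?comp_polyXn_eq0 // -!tofracM -tofracD.
by rewrite raddfN.
Qed.

Lemma rel_frobM x y : rf (x * y) = rf x * rf y.
Proof.
have [n [d [d0 ->]]] := tofrac_surj x; have [n' [d' [d'0 ->]]] := tofrac_surj y.
rewrite mulf_div -!tofracM !rel_frobE ?mulf_neq0 // !comp_polyM !tofracM.
by rewrite mulf_div.
Qed.

Lemma rel_frob1 : rf 1 = 1.
Proof. by rewrite -(rmorph1 (@embP K)) rel_frob_embP. Qed.

Lemma rel_frob0 : rf 0 = 0.
Proof. by rewrite -(subrr 1) rel_frobB !subrr. Qed.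

Lemma rel_frobD x y : rf (x + y) = rf x + rf y.
Proof.
have rfN : rf (- y) = - rf y by rewrite -sub0r rel_frobB rel_frob0 sub0r.
by rewrite -{1}[y]opprK rel_frobB rfN opprK.
Qed.

Lemma rel_frobV x : rf x^-1 = (rf x)^-1.
Proof.
have [->|x0] := eqVneq x 0; first by rewrite invr0 rel_frob0 invr0.
have e : rf x * rf x^-1 = 1 by rewrite -rel_frobM mulfV // rel_frob1.
have rx0 : rf x != 0 by apply/eqP => rx0; move/eqP: e; rewrite rx0 mul0r eq_sym oner_eq0.
exact: (can_inj (mulKf rx0)) (etrans e (esym (mulfV rx0))).
Qed.

Lemma rel_frob_zP : rf (@zP K) = @zP K ^+ p.
Proof. by rewrite rel_frob_poly comp_polyX tofracXn. Qed.

Lemma pchar_KP : p \in [pchar KP K].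
Proof. by rewrite (fmorph_pchar (@embP K)). Qed.

Lemma exprD_pchar (F : fieldType) (x y : F) : p \in [pchar F] ->
  (x + y) ^+ p = x ^+ p + y ^+ p.
Proof. by move=> pF; rewrite -!(pFrobenius_autE pF) rmorphD. Qed.

(** Characteristic p enters through (a + b z)^p = a^p + b^p z^p: the form with coefficients raised
    to the p-th power pulls back to a p-th power. *)
Lemma rel_frob_lin (s : K * K) : rf (lin (s.1 ^+ p, s.2 ^+ p)) = lin s ^+ p.
Proof.
rewrite /lin rel_frobD rel_frobM !rel_frob_embP rel_frob_zP exprD_pchar ?pchar_KP //.
by rewrite exprMn !rmorphXn.
Qed.

Section AtPoint.
Variables (O : set K) (d h : K).
Hypotheses (vO : valuation_ring O) (d0 : d != 0).

Let dp0 : d ^+ p != 0.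
Proof. by rewrite expf_neq0. Qed.

Lemma rel_frob_coord : rf (coord (d ^+ p) (h ^+ p)) = coord d h ^+ p.
Proof.
rewrite /coord rel_frobV exprVn -rel_frob_lin /=.
by rewrite exprMn.
Qed.

Lemma rel_frob_chart x : chart_inf O (d ^+ p) (h ^+ p) x -> chart_inf O d h (rf x).
Proof.
have sA := @chart_inf_subring _ O d h.
move=> hx; apply: (hx [set x | chart_inf O d h (rf x)]).
  split; first by rewrite /= rel_frob1; exact: (subring1 sA).
    by move=> y z hy hz; rewrite /= rel_frobB; exact: (subringB sA).
  by move=> y z hy hz; rewrite /= rel_frobM; exact: (subringM sA).
move=> _ [[a Oa <-]|->] /=; first by rewrite rel_frob_embP; exact: chart_inf_emb.
by rewrite rel_frob_coord; apply: (subringX _ sA); exact: chart_inf_coord.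
Qed.

(** K is fixed and the coordinate u' of the twisted bundle goes to u^p, so the constant term of a
    polynomial in u' is unchanged. *)
Lemma rel_frob_res x r : chart_inf O (d ^+ p) (h ^+ p) x -> res_inf x r ->
  res_inf (rf x) r.
Proof.
move=> /(chart_inf_dec vO dp0)[a [y [Oa Ay e xa]]] /(pg_fun pg xa) <-.
rewrite e rel_frobD rel_frobM rel_frob_embP rel_frob_coord.
rewrite -[X in res_inf _ X]addr0; apply: (pg_add pg); first exact: (pg_emb pg).
have [s ys _] := chart_inf_res vO d0 (rel_frob_chart Ay).
rewrite -(mul0r s); apply: (pg_mul pg) => //.
have -> : 0 = 0 ^+ p :> K by rewrite expr0n eqn0Ngt p_gt0.
by apply: (pg_exp pg); exact: res_coord.
Qed.

Lemma rel_frob_dominates :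
  dominates rf (point_inf O d h) (point_inf O (d ^+ p) (h ^+ p)).
Proof.
have sP : subring (point_inf O d h) by exact: point_inf_subring.
have key x : point_inf O (d ^+ p) (h ^+ p) x -> point_inf O d h (rf x) /\
    forall r, res_inf x r -> res_inf (rf x) r.
  move=> [a [b [Aa Ab cb ->]]].
  have [s [bs s0 Os Osi]] := not_center vO
    (fun x => @chart_inf_res _ O (d ^+ p) (h ^+ p) vO dp0 x) Ab cb.
  have [r ar Or] := chart_inf_res vO dp0 Aa.
  have [Ra Rb] := (rel_frob_res Aa ar, rel_frob_res Ab bs).
  rewrite rel_frobM rel_frobV; split.
    apply: (subringM sP); first by apply: sub_point_inf => //; exact: rel_frob_chart.
    apply: (point_inf_inv vO d0 _ Rb) => //.
    by apply: sub_point_inf => //; exact: rel_frob_chart.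
  move=> t xt; have := pg_mul pg ar (pg_inv pg bs s0).
  move=> /(pg_fun pg xt) ->; exact: (pg_mul pg Ra (pg_inv pg Rb s0)).
move=> x Px; have [Prx xr] := key _ Px; split=> // mx.
have [r xr' Or] := point_inf_res vO dp0 Px.
apply/(point_inf_maxid vO d0 Prx (xr _ xr')).
exact/(point_inf_maxid vO dp0 Px xr').
Qed.

End AtPoint.

(** As p-th powers are additive, the p-th powers of a basis of E generate F^*E. *)
Lemma frob_frame (k : closedFieldType) (iota : {rmorphism k -> K})
  (E : point iota -> set (K * K)) c d h :
  E c = frame (stalkC c) d h ->
  frob_bundle p E c = frame (stalkC c) (d ^+ p) (h ^+ p).
Proof.
move=> Ec; have sO := (stalkC_valuation c).1.
apply/seteqP; split=> [[s1 s2] /= [n [r [u [hu /= -> ->]]]]|_ [al [be [Oal Obe ->]]]].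
  have /choice[al /choice[be hs]] : forall i, exists al, exists be, [/\ stalkC c al,
      stalkC c be & u i = (al + be * (d * h), be * d)].
    by move=> i; have [_] := hu i; rewrite Ec.
  exists (\sum_i r i * al i ^+ p), (\sum_i r i * be i ^+ p); split.
  - apply: (@subring_sum _ (stalkC c) _ _ _ _ sO) => i _; have [ri _] := hu i; have [ai _ _] := hs i.
    by apply: (subringM sO) => //; exact: subringX.
  - apply: (@subring_sum _ (stalkC c) _ _ _ _ sO) => i _; have [ri _] := hu i; have [_ bi _] := hs i.
    by apply: (subringM sO) => //; exact: subringX.
  rewrite !mulr_suml -big_split /=; congr pair; apply: eq_bigr => i _; have [_ _ ->] := hs i.
    by rewrite /= exprD_pchar // !exprMn mulrDr !mulrA.
  by rewrite /= exprMn mulrA.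
exists 2%N, (fun i => if i == 0 then al else be),
  (fun i => if i == 0 then (1, 0) else (d * h, d)); split.
- move=> i; rewrite Ec; case: ifP => _; split=> //.
    exact: frame10 (stalkC_valuation c).
  exact: frame_dh (stalkC_valuation c).
- by rewrite big_ord_recl big_ord1 /= expr1n mulr1 exprMn.
- by rewrite big_ord_recl big_ord1 /= expr0n eqn0Ngt p_gt0 mulr0 add0r.
Qed.

End Frobenius.

(** * Tensor powers of a subsheaf without a chosen generator *)

Section TensorPowers.
Local Open Scope classical_set_scope.
Local Open Scope ring_scope.
Variables (F : fieldType) (L : set F -> set F) (R : set F).
Hypothesis sR : subring R.

Lemma tpow_submodule n : submodule R (tpow L n R).
Proof. by case: n => [|n]; [exact: subring_submodule|exact: span_submodule]. Qed.

Lemma tpowS n x y : L R x -> tpow L n R y -> tpow L n.+1 R (x * y).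
Proof.
by move=> Lx Ly; apply: sub_span; [exact: (subring1 sR)|exists x, y].
Qed.

Lemma tpow1 x : L R x -> tpow L 1 R x.
Proof. by move=> Lx; rewrite -(mulr1 x); apply: (@tpowS 0) => //; exact: (subring1 sR). Qed.

Lemma preim_submodule (M : set F) a : submodule R M ->
  submodule R [set y | M (a * y)].
Proof.
case=> M0 MD MM; split=> [|x y|x y Rx] /=; first by rewrite mulr0.
  by rewrite mulrDr; exact: MD.
by rewrite mulrCA; exact: MM.
Qed.

Lemma tpow_add m n x y : tpow L m R x -> tpow L n R y -> tpow L (m + n) R (x * y).
Proof.
elim: m x y => [|m IH] x y; first by case: (tpow_submodule n) => _ _; apply.
move=> hx Ly; rewrite mulrC; have := hx.
apply: (@span_min _ R _ [set x | tpow L (m.+1 + n) R (y * x)]).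
  by apply: preim_submodule; exact: tpow_submodule.
move=> _ [a [b [La Lb ->]]] /=.
by rewrite mulrC -mulrA; apply: (@tpowS (m + n)) => //; exact: IH.
Qed.

(** For a product in degree i + j >= l of the cyclic algebra: a factor in M^l must be separated, to
    be multiplied by sigma, from one in M^(i+j-l). This is done at every point of P, where no
    generator of M is at hand. *)
Lemma tpow_split m n x : tpow L (m + n) R x ->
  span R [set z | exists a b, [/\ tpow L m R a, tpow L n R b & z = a * b]] x.
Proof.
elim: m x => [|m IH] x.
  move=> Lx; apply: sub_span; first exact: (subring1 sR).
  by exists 1, x; rewrite mul1r; split=> //; exact: (subring1 sR).
apply: span_min; first exact: span_submodule.
move=> _ [a [y [La Ly ->]]]; move: (IH _ Ly).
set B := [set z | _] : set F; set B' := [set z | _] : set F.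
apply: (@span_min _ R _ [set y | span R B' (a * y)]).
  by apply: preim_submodule; exact: span_submodule.
move=> _ [b [c [Lb Lc ->]]]; apply: sub_span; first exact: (subring1 sR).
by exists (a * b), c; rewrite mulrA; split=> //; exact: tpowS.
Qed.

End TensorPowers.

(** * Extending values from a ring to fractions with nonzero denominator value *)

Section FractionPlace.
Local Open Scope ring_scope.
Variables (K F : fieldType) (emb : {rmorphism K -> F}) (Rs : F -> K -> Prop).
Hypotheses (Rs_fun : forall x a b, Rs x a -> Rs x b -> a = b)
  (Rs_emb : forall a, Rs (emb a) a)
  (Rs_sub : forall x y a b, Rs x a -> Rs y b -> Rs (x - y) (a - b))
  (Rs_mul : forall x y a b, Rs x a -> Rs y b -> Rs (x * y) (a * b)).

(** The localisation of the domain of [Rs] at the kernel of the value map; what it adds to the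
    assumed closure properties is [pg_inv]. *)
Definition frac_place (x : F) (r : K) : Prop :=
  exists x1 r1 x2 r2, [/\ Rs x1 r1, Rs x2 r2, r2 != 0, x = x1 / x2 & r = r1 / r2].

Lemma frac_place_graph : place_graph emb frac_place.
Proof.
have nz x r : Rs x r -> r != 0 -> x != 0.
  move=> xr; apply: contra_neq => x0; apply: (Rs_fun xr).
  by rewrite x0 -(rmorph0 emb).
split.
- move=> x a b [x1 [r1 [x2 [r2 [h1 h2 n2 -> ->]]]]].
  move=> [y1 [s1 [y2 [s2 [g1 g2 m2 + ->]]]]].
  move=> /(eq_divf _ _ (nz _ _ h2 n2) (nz _ _ g2 m2)) e; apply/eq_divf => //.
  by apply: (Rs_fun (Rs_mul h1 g2)); rewrite e; exact: Rs_mul.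
- move=> a; exists (emb a), a, 1, 1; rewrite !divr1 oner_neq0; split=> //.
  by rewrite -[X in Rs X](rmorph1 emb).
- move=> x y a b [x1 [r1 [x2 [r2 [h1 h2 n2 -> ->]]]]].
  move=> [y1 [s1 [y2 [s2 [g1 g2 m2 -> ->]]]]].
  exists (x1 * y2 - y1 * x2), (r1 * s2 - s1 * r2), (x2 * y2), (r2 * s2); split.
  + by apply: Rs_sub; exact: Rs_mul.
  + exact: Rs_mul.
  + by rewrite mulf_neq0.
  + by rewrite -mulNr addf_div ?mulNr // ?(nz _ _ h2 n2) ?(nz _ _ g2 m2).
  + by rewrite -mulNr addf_div ?mulNr.
- move=> x y a b [x1 [r1 [x2 [r2 [h1 h2 n2 -> ->]]]]].
  move=> [y1 [s1 [y2 [s2 [g1 g2 m2 -> ->]]]]].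
  exists (x1 * y1), (r1 * s1), (x2 * y2), (r2 * s2); split.
  + exact: Rs_mul.
  + exact: Rs_mul.
  + by rewrite mulf_neq0.
  + by rewrite mulf_div.
  + by rewrite mulf_div.
- move=> x a [x1 [r1 [x2 [r2 [h1 h2 n2 -> ->]]]]] h.
  exists x2, r2, x1, r1; rewrite !invf_div; split=> //.
  by apply: contra_neq h => ->; rewrite mul0r.
Qed.

Lemma sub_frac_place x r : Rs x r -> frac_place x r.
Proof.
move=> xr; exists x, r, 1, 1; rewrite !divr1 oner_neq0; split=> //.
by rewrite -[X in Rs X](rmorph1 emb).
Qed.

End FractionPlace.

Section Generators.
Local Open Scope ring_scope.
Context {k : closedFieldType} {K : fieldType} {iota : {rmorphism k -> K}}.

Definition div_gen (D : place iota -> int) (c : point iota) : K :=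
  s2val (cid2 (divisor_generator D c)).

Lemma div_gen_neq0 D c : div_gen D c != 0.
Proof. exact: s2valP (cid2 (divisor_generator D c)). Qed.

Lemma ord_div_gen D v : ord v (div_gen D (Some v)) = - D v.
Proof. by have := s2valP' (cid2 (divisor_generator D (Some v))); apply. Qed.

Lemma OC_gen D c : OC D c = prin (stalkC c) (div_gen D c).
Proof.
apply: OC_prin; first exact: div_gen_neq0.
by move=> v ->; exact: ord_div_gen.
Qed.

End Generators.

HB.instance Definition _ (k : closedFieldType) (K : fieldType)
    (iota : {rmorphism k -> K}) (p : nat) (S : raynaud iota p) :=
  GRing.RMorphism.copy (@embX k K iota p S) (rj S \o @embP K).

(** * The ruled surface *)

Section RuledSurface.
Local Open Scope classical_set_scope.
Local Open Scope ring_scope.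
Context {k : closedFieldType} {K : fieldType} {iota : {rmorphism k -> K}} {p : nat}.
Variable S : raynaud iota p.
Hypothesis hp : p \in [pchar K].
Implicit Types (c : point iota) (R : set (KP K)).

Let pg := @res_inf_graph K.

Definition dE c : K := div_gen (rD S) c.
Definition nE c : K := div_gen (rNl S) c.
(** At the generic point the stalk is all of [K * K], so any lift may be chosen; 0 is taken. *)
Definition hE c : K := if c is Some v then rh S v else 0.

(* The local ring of P at the point of E over c, and an equation of E there. *)
Definition RE c : set (KP K) := point_inf (stalkC c) (dE c) (hE c).
Definition uE c : KP K := coord (dE c) (hE c).

Lemma dE_neq0 c : dE c != 0.
Proof. exact: div_gen_neq0. Qed.

Lemma nE_neq0 c : nE c != 0.
Proof. exact: div_gen_neq0. Qed.

Let vO c := @stalkC_valuation _ _ iota c.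

Lemma rE_frame c : rE S c = frame (stalkC c) (dE c) (hE c).
Proof.
have d0 := dE_neq0 c.
have aux (a b h : K) : (a, b) = (a - b * h + b / dE c * (dE c * h), b / dE c * dE c).
  by rewrite mulrA divfK // subrK.
apply/seteqP; split=> [[a b]|_ [al [be [Oal Obe ->]]]] /=.
  move=> hs; exists (a - b * hE c), (b / dE c); split=> //.
    by case: c hs {d0 aux} => [v /= [_]|].
  case: c d0 hs {aux} => [v|//] d0 [hb _].
  have : OC (rD S) (Some v) b := hb.
  by rewrite OC_gen => /(prinE _ _ d0).
rewrite /rE /extension; case: c d0 Oal Obe {aux} => [v|//] d0 Oal Obe /=.
split; last by rewrite -mulrA addrK.
suff : OC (rD S) (Some v) (be * dE (Some v)) by [].
by rewrite OC_gen; apply/(prinE _ _ d0); rewrite mulfK.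
Qed.

Lemma RE_subring c : subring (RE c).
Proof. exact: point_inf_subring (vO c) (dE_neq0 c). Qed.

Lemma RE_proj c : rP S (RE c).
Proof. exact: projE_point_inf (dE_neq0 c) (rE_frame c). Qed.

Lemma RE_dom c : dominates (@embP K) (RE c) (stalkC c).
Proof. exact: point_inf_dominates (vO c) (dE_neq0 c). Qed.

Lemma uE_neq0 c : uE c != 0.
Proof. exact: coord_neq0 (dE_neq0 c). Qed.

Lemma dual_O1_RE c : dual (O1 (rE S)) (RE c) = prin (RE c) (uE c).
Proof.
apply: dual_prin; [exact: RE_subring|exact: lin_dh_neq0 (dE_neq0 c)|].
exact: O1_point_inf (dE_neq0 c) (rE_frame c).
Qed.

Lemma rEidealE R : rEideal S R = dual (O1 (rE S)) R.
Proof.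
apply/seteqP; split=> [_ [x hx <-]|x hx]; first by rewrite lin10 mul1r.
by exists x => //; rewrite lin10 mul1r.
Qed.

Definition qE : nat := p.+1 %/ rl S.

Definition mE c : KP K := uE c ^+ qE * embP (nE c ^+ p).

Lemma mE_neq0 c : mE c != 0.
Proof. by rewrite mulf_neq0 ?expf_neq0 ?uE_neq0 ?fmorph_eq0 ?expf_neq0 ?nE_neq0. Qed.

Lemma rM_RE c : rM S (RE c) = prin (RE c) (mE c).
Proof.
apply: tensor_prin; first exact: RE_subring.
  by apply: tpow_prin; [exact: RE_subring|exact: dual_O1_RE].
apply: (pullC_prin (RE_subring c) (@RE_dom c)); apply: OC_prin.
  by rewrite expf_neq0 ?nE_neq0.
by move=> v ->; rewrite ordX ord_div_gen /mul_div mulrN.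
Qed.

Definition cE c : K := dE c ^+ p * (rtau S - hE c ^+ p).

Lemma OC_pD c : OC (mul_div p%:Z (rD S)) c = prin (stalkC c) (dE c ^+ p).
Proof.
apply: OC_prin; first by rewrite expf_neq0 ?dE_neq0.
by move=> v ->; rewrite ordX ord_div_gen /mul_div mulrN.
Qed.

Lemma OC_NpD c : OC (mul_div (- p%:Z) (rD S)) c = prin (stalkC c) (dE c ^- p).
Proof.
apply: OC_prin; first by rewrite invr_eq0 expf_neq0 ?dE_neq0.
by move=> v ->; rewrite ordV ordX ord_div_gen /mul_div; ring.
Qed.

Lemma frob_tau c : frob_bundle p (rE S) c (dE c ^+ p * rtau S, dE c ^+ p).
Proof.
apply: (@rtauP _ _ _ _ S); rewrite OC_pD; exists 1; rewrite ?mulr1 //.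
exact: (subring1 (vO c).1).
Qed.

(** The section tau e_0 + e_1 of O(1) (x) L^-p is regular everywhere: the splitting puts its
    multiple by d^p in F^*E, and d^-p generates L^-p. Hence its product with a local section of the
    dual sheaf lies in R'. *)
Lemma rGamma_sub R' : projE (frob_bundle p (rE S)) R' -> rGamma S R' `<=` R'.
Proof.
move=> hR' _ [y hy <-]; rewrite mulrC; apply: hy.
have sR' := projE_subring hR'; have [c hc] := projE_over hR'.
have R1 := subring1 sR'; apply: sub_span => //.
exists (embP (dE c ^+ p) * lin (rtau S, 1)), (embP (dE c ^- p)); split.
- rewrite -linZ /= mulr1 /O1 (pull_genE _ _ hc); apply: sub_span => //.
  by exists (dE c ^+ p * rtau S, dE c ^+ p) => //; exact: frob_tau.
- rewrite (pullC_prin sR' hc (OC_NpD c)); exists 1 => //; exact: mulr1.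
- rewrite mulrAC -rmorphM mulfV ?expf_neq0 ?dE_neq0 //.
  by rewrite rmorph1 mul1r.
Qed.

Lemma rCideal_sub R : subring R -> rCideal S R `<=` R.
Proof.
move=> sR x [R' [hR' dR]]; apply: span_sub_subring => //.
by move=> _ [y /(rGamma_sub hR') Ry <-]; case: (dR _ Ry).
Qed.

(* On E the equation of C'' becomes (z^p + tau) / (z + h)^p, a unit. *)
Lemma rCideal_RE c : rCideal S (RE c) = RE c.
Proof.
have sR := RE_subring c; apply/seteqP; split; first exact: rCideal_sub.
have d0 := dE_neq0 c; have dp0 : dE c ^+ p != 0 by rewrite expf_neq0.
have frob_c := frob_frame hp (rE_frame c).
pose R' := point_inf (stalkC c) (dE c ^+ p) (hE c ^+ p).
have hR' : projE (frob_bundle p (rE S)) R' by exact: projE_point_inf dp0 frob_c.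
have sR' : subring R' by exact: point_inf_subring (vO c) dp0.
have dR : dominates (@rel_frob K p) (RE c) R' by exact: rel_frob_dominates.
have dRc : dominates (@embP K) R' (stalkC c) by exact: point_inf_dominates.
pose u' := coord (dE c ^+ p) (hE c ^+ p).
(* y = (z + tau) / (z + h^p), the equation of Gamma' at R': the section divided by the local
   generator of O(1) (x) L^-p. *)
pose y := lin (rtau S, 1) * (u' * embP (dE c ^+ p)).
have Gy : rGamma S R' y.
  exists (u' * embP (dE c ^+ p)) => //.
  have -> : u' * embP (dE c ^+ p) =
      (lin (dE c ^+ p * hE c ^+ p, dE c ^+ p) * embP (dE c ^- p))^-1.
    by rewrite invfM -fmorphV invrK.
  rewrite (dual_prin (x := lin (dE c ^+ p * hE c ^+ p, dE c ^+ p) * embP (dE c ^- p))) //.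
  - by exists 1; [exact: (subring1 sR')|exact: mulr1].
  - by rewrite mulf_neq0 ?lin_dh_neq0 // fmorph_eq0 invr_eq0.
  apply: tensor_prin => //; first exact: O1_point_inf dp0 frob_c.
  exact: (pullC_prin sR' dRc (OC_NpD c)).
have ye : rel_frob p y = 1 + embP (cE c) * uE c ^+ p.
  have up0 : lin (dE c * hE c, dE c) ^+ p * uE c ^+ p = 1.
    by rewrite -exprMn mulfV ?expr1n // lin_dh_neq0.
  rewrite -[X in _ = X + _]up0 -mulrDl /y !(rel_frobM hp) (rel_frob_embP hp).
  rewrite (rel_frob_coord hp) mulrA mulrAC; congr (_ * _).
  rewrite -(rel_frob_lin hp) /= -(rel_frob_embP hp (cE c)) -(rel_frobD hp).
  rewrite -[embP (dE c ^+ p)](rel_frob_embP hp) -(rel_frobM hp) mulrC -linZ /=.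
  congr (rel_frob p _); rewrite mulr1 -[embP (cE c)]mulr1 -lin10 -linZ -linD.
  by congr lin; congr pair; rewrite /= ?mulr0 ?addr0 // mulr1 /cE exprMn mulrBr addrC subrK.
have Ru : RE c (uE c) by exact: point_inf_coord.
have Ry : RE c (rel_frob p y).
  by case: (dR y _) => //; exact: rGamma_sub Gy.
have res1 : res_inf (rel_frob p y) 1.
  rewrite ye -[X in res_inf _ X]addr0; apply: (pg_add pg); first exact: (pg1 pg).
  have -> : 0 = cE c * 0 ^+ p by rewrite expr0n eqn0Ngt prime_gt0 ?mulr0 ?(pcharf_prime hp).
  apply: (pg_mul pg); first exact: (pg_emb pg).
  by apply: (pg_exp pg); exact: res_coord.
have Ryi : RE c (rel_frob p y)^-1.
  apply: point_inf_inv Ry res1 _ _ => //; first exact: oner_neq0.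
  by rewrite invr1; exact: (subring1 (vO c).1).
have y0 : rel_frob p y != 0 by exact: (pg_neq0 pg res1 (oner_neq0 _)).
move=> x Rx; exists R'; split=> //.
rewrite -[x](divfK y0); have [_ _ sM] := span_submodule (rel_frob p @` rGamma S R') sR.
apply: sM; first exact: (subringM sR).
by apply: sub_span; [exact: (subring1 sR)|exists y].
Qed.

Definition eE c : KP K := rsigma S * mE c ^+ rl S / uE c.

(** Only the ideal sigma M^l = I_E I_C'' is known. At the point of E over c it has the two
    generators sigma m^l and u, the second because I_C'' is trivial there; they differ by a unit. *)
Lemma eE_spec c : [/\ RE c (eE c), RE c (eE c)^-1, eE c != 0 &
  rsigma S * mE c ^+ rl S = uE c * eE c].
Proof.
have sR := RE_subring c; have u0 := uE_neq0 c; have R1 := subring1 sR.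
have sm0 : rsigma S * mE c ^+ rl S != 0.
  by rewrite mulf_neq0 ?rsigma_neq0 ?expf_neq0 ?mE_neq0.
have h := rsigmaP (RE_proj c).
have hu : tensor (rEideal S) (rCideal S) (RE c) = prin (RE c) (uE c).
  rewrite -[X in prin _ X]mulr1; apply: tensor_prin => //.
    by rewrite rEidealE dual_O1_RE.
  by rewrite rCideal_RE prin1.
rewrite hu (tpow_prin (rl S) sR (rM_RE c)) in h.
split; last by rewrite /eE [RHS]mulrC divfK.
- apply/(prinE _ _ u0); rewrite -h; exists (mE c ^+ rl S) => //.
  by exists 1; rewrite ?mulr1.
- rewrite /eE invf_div; apply/(prinE _ _ sm0).
  have : prin (RE c) (uE c) (uE c) by exists 1; rewrite ?mulr1.
  by rewrite -h => -[_ [y Ry <-] <-]; exists y; rewrite ?mulrA.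
- exact: (mulf_neq0 sm0 (invr_neq0 u0)).
Qed.

Lemma res_uE c : res_inf (uE c) 0.
Proof. exact: res_coord (dE_neq0 c). Qed.

Lemma RE_uE c : RE c (uE c).
Proof. exact: point_inf_coord (vO c) (dE_neq0 c). Qed.

Lemma RE_res c x : RE c x -> exists2 r, res_inf x r & stalkC c r.
Proof. exact: point_inf_res (vO c) (dE_neq0 c) _. Qed.

Lemma RE_inv_generic x r : RE None x -> res_inf x r -> r != 0 -> RE None x^-1.
Proof. by move=> hx xr r0; exact: (point_inf_inv (vO None) (dE_neq0 None) hx xr). Qed.

(** Near the generic point of E both are equations of E. On E the ratio depends only on the images
    in L of the two frame vectors, not on the lifts h. *)
Lemma uE_ratio c : RE None (uE c / uE None) /\
  res_inf (uE c / uE None) (dE None / dE c).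
Proof.
have d0 := dE_neq0 None; have dc0 := dE_neq0 c.
have [al [be [_ _ e es]]] : exists al be, [/\ stalkC (None : point iota) al,
    stalkC (None : point iota) be,
    (dE c * hE c, dE c) = (al + be * (dE None * hE None), be * dE None) &
    lin (dE c * hE c, dE c) * uE None = embP be + embP al * uE None].
  by apply: lin_frame_coord => //; rewrite -rE_frame.
have R0 := RE_subring None.
have er : uE c / uE None = (lin (dE c * hE c, dE c) * uE None)^-1.
  by rewrite invfM.
split; last first.
  have -> : uE c / uE None = lin (dE None * hE None, dE None) / lin (dE c * hE c, dE c).
    by rewrite /uE /coord invrK mulrC.
  exact: (@res_lin _ (dE c * hE c, dE c) (dE None * hE None, dE None)).
have be0 : be != 0.
  by apply: contra_neq dc0 => be0; case: e => _ ->; rewrite be0 mul0r.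
rewrite er es; apply: (RE_inv_generic (r := be)) => //.
  apply: (subringD R0); first by case: (RE_dom (c := None) (a := be)).
  apply: (subringM R0); first by case: (RE_dom (c := None) (a := al)).
  exact: RE_uE.
rewrite -[X in res_inf _ X]addr0 -(mulr0 al); apply: (pg_add pg).
  exact: (pg_emb pg).
by apply: (pg_mul pg); [exact: (pg_emb pg)|exact: res_uE].
Qed.

Lemma RE_sub_generic c : RE c `<=` RE None.
Proof.
have R0 := RE_subring None.
have E0 a : RE None (embP a) by case: (RE_dom (c := None) (a := a)).
have u_c : RE None (uE c).
  rewrite -[uE c](divfK (uE_neq0 None)); apply: (subringM R0); last exact: RE_uE.
  by case: (uE_ratio c).
have sub : chart_inf (stalkC c) (dE c) (hE c) `<=` RE None.
  by move=> x; apply=> // _ [[a _ <-]|->].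
move=> _ [a [b [Aa Ab cb ->]]].
have [r [br r0 _ _]] := not_center (vO c)
    (fun x => @chart_inf_res _ (stalkC c) (dE c) (hE c) (vO c) (dE_neq0 c) x) Ab cb.
apply: (subringM R0); first exact: sub.
by apply: RE_inv_generic br r0; exact: sub.
Qed.

Definition rhoE c : K := (dE None / dE c) ^+ qE * (nE c / nE None) ^+ p.

Lemma rhoE_neq0 c : rhoE c != 0.
Proof.
by rewrite mulf_neq0 // expf_neq0 // mulf_neq0 ?invr_eq0 ?dE_neq0 ?nE_neq0.
Qed.

Lemma mE_ratio c : RE None (mE c / mE None) /\ res_inf (mE c / mE None) (rhoE c).
Proof.
have R0 := RE_subring None; have [Ru ru] := uE_ratio c.
have E0 a : RE None (embP a) by case: (RE_dom (c := None) (a := a)).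
have -> : mE c / mE None = (uE c / uE None) ^+ qE * embP ((nE c / nE None) ^+ p).
  rewrite /mE -mulf_div -exprVn -exprMn; congr (_ * _).
  by rewrite -fmorphV -rmorphM -exprVn -exprMn.
split; first by apply: (subringM R0) => //; exact: subringX.
by apply: (pg_mul pg); [exact: (pg_exp pg)|exact: (pg_emb pg)].
Qed.

End RuledSurface.

(** * The cyclic cover *)

Section CyclicCover.
Local Open Scope classical_set_scope.
Local Open Scope ring_scope.
Context {k : closedFieldType} {K : fieldType} {iota : {rmorphism k -> K}} {p : nat}.
Variable S : raynaud iota p.
Hypothesis hp : p \in [pchar K].
Implicit Types (c : point iota) (R : set (KP K)) (T : set (rKX S)).

Let pg := @res_inf_graph K.
Let vO c := @stalkC_valuation _ _ iota c.
Let l := rl S.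
Let w := rw S.
Lemma rl_gt0 : (0 < rl S)%N.
Proof. exact: leq_trans (rl_ge2 S). Qed.
Let l_gt0 : (0 < l)%N := rl_gt0.

Local Notation AX := (@cyclic_algebra k K iota p S).

Lemma cyclic_term R i a : subring R -> (i < l)%N -> tpow (rM S) i R a ->
  AX R (rj S a * w ^+ i).
Proof.
move=> sR il hai; exists (fun j => if j == Ordinal il then a else 0); split.
  move=> j; case: eqP => [->//|_].
  by case: (@tpow_submodule _ (rM S) R sR j).
rewrite (bigD1 (Ordinal il)) //= eqxx big1 ?addr0 // => j /negPf ->.
by rewrite rmorph0 mul0r.
Qed.

Lemma cyclic_add R x y : subring R -> AX R x -> AX R y -> AX R (x + y).
Proof.
move=> sR [a [ha ->]] [b [hb ->]]; exists (fun i => a i + b i); split.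
  move=> i; have [_ hD _] := @tpow_submodule _ (rM S) R sR i.
  by apply: hD; [exact: ha|exact: hb].
by rewrite -big_split /=; apply: eq_bigr => i _; rewrite rmorphD mulrDl.
Qed.

Lemma cyclic0 R : subring R -> AX R 0.
Proof.
move=> sR; rewrite -(mul0r (w ^+ 0)) -(rmorph0 (rj S)).
by apply: cyclic_term => //; exact: subring0.
Qed.

Lemma cyclic_rj R a : subring R -> R a -> AX R (rj S a).
Proof. by move=> sR Ra; rewrite -[rj S a]mulr1 -(expr0 w); exact: cyclic_term. Qed.

(** In degrees i + j >= l the relation w^l = sigma lowers the degree by l, and the coefficient stays
    admissible because sigma M^l = I_E I_C'' is contained in R. *)
Lemma cyclic_subring R : rP S R -> subring (AX R).
Proof.
move=> hR; have sR : subring R by exact: projE_subring hR.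
have mterm (i j : 'I_l) a b : tpow (rM S) i R a -> tpow (rM S) j R b ->
    AX R (rj S (a * b) * w ^+ (i + j)).
  move=> hai hbj; have hab := tpow_add sR hai hbj.
  have [ijl|lij] := ltnP (i + j) l; first exact: cyclic_term.
  pose m := (i + j - l)%N; have e : (i + j = l + m)%N by rewrite subnKC.
  rewrite e exprD rwP mulrA -rmorphM.
  apply: cyclic_term => //; first by rewrite /m; have := ltn_ord i; have := ltn_ord j; lia.
  rewrite e in hab; rewrite mulrC; move: (tpow_split sR hab).
  apply: (@span_min _ R _ [set x | tpow (rM S) m R (rsigma S * x)]).
    by apply: preim_submodule; exact: tpow_submodule.
  move=> _ [x [y [hx hy ->]]] /=; rewrite mulrA.
  have [_ _ mM] := @tpow_submodule _ (rM S) R sR m; apply: mM => //.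
  have : tensor (rEideal S) (rCideal S) R (rsigma S * x).
    by rewrite -rsigmaP //; exists x.
  apply: span_sub_subring => // _ [y1 [y2 [h1 h2 ->]]].
  apply: (subringM sR); last exact: rCideal_sub h2.
  (* I_E is the dual of O(1), and O(1) contains 1 = [lin (1, 0)], so I_E is contained in R. *)
  move: h1; rewrite rEidealE => h1; rewrite -(mulr1 y1) -lin10; apply: h1.
  have [c hc] := projE_over hR; rewrite /O1 (pull_genE _ _ hc).
  apply: sub_span; first exact: (subring1 sR).
  by exists (1, 0) => //; rewrite rE_frame; exact: frame10.
split.
- by rewrite -(rmorph1 (rj S)); apply: cyclic_rj => //; exact: (subring1 sR).
- move=> x y hx [b [hb ->]]; apply: cyclic_add => //.
  rewrite -sumrN; exists (fun i => - b i); split.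
    move=> i; have [_ _ mM] := @tpow_submodule _ (rM S) R sR i.
    by rewrite -mulN1r; apply: mM => //; apply: (subringN sR); exact: (subring1 sR).
  by apply: eq_bigr => i _; rewrite rmorphN mulNr.
- move=> _ _ [a [ha ->]] [b [hb ->]]; rewrite mulr_suml.
  apply: (@big_ind _ (AX R)) => [|x y|i _]; [exact: cyclic0|exact: cyclic_add|].
  rewrite mulr_sumr.
  apply: (@big_ind _ (AX R)) => [|x y|j _]; [exact: cyclic0|exact: cyclic_add|].
  by rewrite mulrACA -rmorphM -exprD; exact: mterm.
Qed.

Lemma surface_subring T : surface S T -> subring T.
Proof. by move=> [R [q [hR qP _ ->]]]; apply: localize_subring => //; exact: cyclic_subring. Qed.

Lemma cyclic_dominates R q : rP S R -> prime_ideal (AX R) q ->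
  (forall a, R a -> (q (rj S a) <-> maxid R a)) ->
  dominates (rj S) (localize (AX R) q) R.
Proof.
move=> hR qP qc; have sR : subring R by exact: projE_subring hR.
apply: localize_dominates => //; first exact: cyclic_subring.
  by move=> a; exact: cyclic_rj.
by move=> a Ra /(proj2 (qc _ Ra)).
Qed.

Lemma surface_over T : surface S T -> exists c, lies_over (embX S) T c.
Proof.
move=> [R [q [hR qP qc ->]]]; have [c hc] := projE_over hR; exists c.
exact: dominates_trans (cyclic_dominates hR qP qc) hc.
Qed.

Local Notation dE := (dE S).
Local Notation nE := (nE S).
Local Notation hE := (hE S).
Local Notation RE := (RE S).
Local Notation uE := (uE S).
Local Notation mE := (mE S).
Local Notation eE := (eE S).

(* tE generates the ideal of \tilde E at its point over c. *)
Definition tE c : rKX S := rj S (mE c) * w.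

Lemma tE_neq0 c : tE c != 0.
Proof.
rewrite mulf_neq0 ?fmorph_eq0 ?mE_neq0 //; apply/eqP => w0.
have := rwP S; rewrite -/w -/l w0 expr0n eqn0Ngt l_gt0 => /esym/eqP.
by rewrite fmorph_eq0 (negPf (rsigma_neq0 S)).
Qed.

Lemma tE_exp c : tE c ^+ l = rj S (uE c * eE c).
Proof.
have [_ _ _ <-] := eE_spec S hp c.
by rewrite exprMn -rmorphXn rwP -rmorphM mulrC.
Qed.

Definition AE c : set (rKX S) := AX (RE c).
Let sRE c : subring (RE c) := RE_subring S c.

Lemma AE_subring c : subring (AE c).
Proof. exact: cyclic_subring (RE_proj S c). Qed.

Lemma AE_rj c a : RE c a -> AE c (rj S a).
Proof. exact: cyclic_rj (sRE c). Qed.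

Lemma AE_tE c : AE c (tE c).
Proof.
(* Degree 1 is present in the algebra because l >= 2. *)
rewrite /tE -[w]expr1; apply: cyclic_term (sRE c) _ _; first exact: rl_ge2 S.
apply: tpow1 => //; rewrite rM_RE; exists 1; rewrite ?mulr1 //.
exact: (subring1 (sRE c)).
Qed.

(** M^i is generated by m^i at this point, so the algebra is spanned over R by 1, t, ...,
    t^(l-1). *)
Lemma AE_sum c x : AE c x <-> exists a : 'I_l -> KP K,
  (forall i, RE c (a i)) /\ x = \sum_(i < l) rj S (a i) * tE c ^+ i.
Proof.
have tE_term i a : rj S (mE c ^+ i * a) * w ^+ i = rj S a * tE c ^+ i.
  by rewrite /tE [in RHS]exprMn rmorphM rmorphXn mulrA [rj S a * _]mulrC.
split=> [[a [ha ->]]|[a [ha ->]]].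
  have /choice[b hb] (i : 'I_l) : exists b, RE c b /\ mE c ^+ i * b = a i.
    by have := ha i; rewrite (tpow_prin i (sRE c) (rM_RE S c)) => -[b Rb e]; exists b.
  exists b; split=> [i|]; first by case: (hb i).
  by apply: eq_bigr => i _; rewrite -tE_term; case: (hb i) => _ ->.
exists (fun i : 'I_l => mE c ^+ i * a i); split=> [i|].
  by rewrite (tpow_prin i (sRE c) (rM_RE S c)); exists (a i).
by apply: eq_bigr => i _; rewrite -tE_term.
Qed.

Lemma AE_dec c x : AE c x -> exists a y, [/\ RE c a, AE c y & x = rj S a + tE c * y].
Proof.
move=> /AE_sum[a [ha ->]]; have sA := AE_subring c.
pose i0 := Ordinal l_gt0.
exists (a i0), (\sum_(i < l | i != i0) rj S (a i) * tE c ^+ i.-1); split=> //.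
  apply: (@subring_sum _ (AE c) _ _ _ _ sA) => i _.
  apply: (subringM sA); first exact: AE_rj.
  by apply: (subringX _ sA); exact: AE_tE.
rewrite (bigD1 i0) //= expr0 mulr1; congr (_ + _); rewrite mulr_sumr.
apply: eq_bigr => i ii0; rewrite mulrCA -exprS prednK // lt0n.
by apply: contra ii0 => /eqP e; apply/eqP/val_inj.
Qed.

Lemma rj_coef0 (a : KP K) (b : 'I_l -> KP K) :
  rj S a = \sum_(i < l) rj S (b i) * w ^+ i -> a = b (Ordinal l_gt0).
Proof.
move=> e; have [f [_ funiq]] := rKX_basis (r := S) (rj S a).
pose f1 : {ffun 'I_l -> KP K} := [ffun i => if i == Ordinal l_gt0 then a else 0].
pose f2 : {ffun 'I_l -> KP K} := [ffun i => b i].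
have e1 : f = f1.
  apply: funiq; rewrite (bigD1 (Ordinal l_gt0)) //= ffunE eqxx expr0 mulr1.
  by rewrite big1 ?addr0 // => i /negPf h; rewrite ffunE h rmorph0 mul0r.
have e2 : f = f2 by apply: funiq; rewrite e; apply: eq_bigr => i _; rewrite ffunE.
by have := congr1 (fun g : {ffun 'I_l -> KP K} => g (Ordinal l_gt0)) (etrans (esym e1) e2);
  rewrite /= !ffunE eqxx.
Qed.

(** Multiplication by t shifts coefficients, and the constant one comes only from the top
    coefficient times t^l = u e. So tA meets R in uR, which makes values on \tilde E well
    defined. *)
Lemma tE_mul_rj c a y : AE c y -> rj S a = tE c * y ->
  exists2 b, RE c b & a = uE c * b.
Proof.
move=> /AE_sum[b [hb ->]] e.
have [Re _ _ _] := eE_spec S hp c.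
have ll : l = l.-1.+1 by rewrite prednK.
pose bn n := if insub n is Some i then b i else 0.
have bnE (i : 'I_l) : bn i = b i by rewrite /bn valK.
have Rbn n : RE c (bn n).
  by rewrite /bn; case: insubP => [i _ _|_]; [exact: hb|exact: (subring0 (sRE c))].
(* The coordinates of t y in the basis w^i: index 0 receives the top coefficient of y wrapped around
   through t^l, and the other indices are shifted by one. *)
pose f i := if i is j.+1 then mE c ^+ i * bn j else uE c * (eE c * bn l.-1).
exists (eE c * bn l.-1); first exact: (subringM (sRE c)).
have -> // : a = f (Ordinal l_gt0).
apply: (@rj_coef0 a (fun i => f i)); rewrite e.
under eq_bigr do rewrite -bnE.
rewrite -(big_mkord xpredT (fun i => rj S (bn i) * tE c ^+ i)).
rewrite -(big_mkord xpredT (fun i => rj S (f i) * w ^+ i)).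
rewrite [in LHS]ll [in RHS]ll big_nat_recr //= big_nat_recl //= expr0 mulr1 addrC mulrDr.
congr (_ + _).
  rewrite mulrCA -exprS -ll tE_exp -rmorphM; congr (rj S _).
  by rewrite mulrC mulrA.
rewrite mulr_sumr; apply: eq_bigr => i _.
by rewrite mulrCA -exprS /tE exprMn rmorphM rmorphXn mulrA [rj S _ * _]mulrC.
Qed.

End CyclicCover.

Arguments AE {k K iota p} S c _.

(** * The curve \tilde E: values along it, its points and its ideal *)

Section SectionE.
Local Open Scope classical_set_scope.
Local Open Scope ring_scope.
Context {k : closedFieldType} {K : fieldType} {iota : {rmorphism k -> K}} {p : nat}.
Variable S : raynaud iota p.
Hypothesis hp : p \in [pchar K].
Implicit Types (c : point iota) (R : set (KP K)) (T : set (rKX S)).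

Let pg := @res_inf_graph K.
Let vO c := @stalkC_valuation _ _ iota c.
Let sR c := RE_subring S c.
Let sA c := AE_subring S hp c.

(* Values at the generic point of \tilde E. *)
Definition value_AE (x : rKX S) (r : K) : Prop :=
  exists a y, [/\ RE S None a, AE S None y, x = rj S a + tE S None * y & res_inf a r].

Definition value (x : rKX S) (r : K) : Prop := frac_place value_AE x r.

Lemma res_uE_mul c a : RE S c a -> res_inf (uE S c * a) 0.
Proof.
move=> Ra; have [s as_ _] := RE_res Ra.
by rewrite -(mul0r s); apply: (pg_mul pg) => //; exact: res_uE.
Qed.

Lemma value_AE_emb a : value_AE (embX S a) a.
Proof.
exists (embP a), 0; rewrite mulr0 addr0; split=> //.
- by case: (@RE_dom _ _ _ _ S None a).
- exact: (subring0 (sA None)).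
- exact: (pg_emb pg).
Qed.

(** A / tA is R / uR: two decompositions of the same element have constant terms differing by an
    element of uR, hence the same value at z = oo. *)
Lemma value_graph : place_graph (embX S) value.
Proof.
have A0 := sA None; have R0 := sR None; apply: frac_place_graph.
- move=> x r r' [a [y [Ra Ay -> ar]]] [a' [y' [Ra' Ay' e ar']]].
  have [| |b Rb eb] := @tE_mul_rj _ _ _ _ S hp None (a - a') (y' - y).
  + exact: (subringB A0).
  + by rewrite rmorphB mulrBr; apply: (canRL (addrK _)); rewrite addrAC e addrC addKr.
  have := pg_sub pg ar ar'; rewrite eb => /(pg_fun pg (res_uE_mul Rb)).
  by move/esym/eqP; rewrite subr_eq0 => /eqP.
- exact: value_AE_emb.
- move=> x x' r r' [a [y [Ra Ay -> ar]]] [a' [y' [Ra' Ay' -> ar']]].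
  exists (a - a'), (y - y'); split.
  + exact: (subringB R0).
  + exact: (subringB A0).
  + by rewrite rmorphB mulrBr opprD addrACA.
  + exact: (pg_sub pg).
- move=> x x' r r' [a [y [Ra Ay -> ar]]] [a' [y' [Ra' Ay' -> ar']]].
  exists (a * a'), (rj S a * y' + rj S a' * y + tE S None * y * y'); split.
  + exact: (subringM R0).
  + have Aa := AE_rj Ra; have Aa' := AE_rj Ra'; have At := AE_tE S None.
    apply: (subringD A0); first by apply: (subringD A0); exact: (subringM A0).
    by apply: (subringM A0) => //; exact: (subringM A0).
  + rewrite rmorphM; move: (rj S a) (rj S a') (tE S None) => u v t; ring.
  + exact: (pg_mul pg).
Qed.

Let pgX := value_graph.

Lemma value_rj a r : RE S None a -> res_inf a r -> value (rj S a) r.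
Proof.
move=> Ra ar; apply: (sub_frac_place value_AE_emb).
by exists a, 0; rewrite mulr0 addr0; split=> //; exact: (subring0 (sA None)).
Qed.

Lemma value_tE0 : value (tE S None) 0.
Proof.
apply: (sub_frac_place value_AE_emb).
exists 0, 1; rewrite rmorph0 mulr1 add0r; split=> //.
- exact: (subring0 (sR None)).
- exact: (subring1 (sA None)).
- by rewrite -(rmorph0 (@embP K)); exact: (pg_emb pg).
Qed.

Lemma tE_ratio c : tE S c = rj S (mE S c / mE S None) * tE S None.
Proof. by rewrite /tE mulrA -rmorphM divfK // mE_neq0. Qed.

Lemma value_tE c : value (tE S c) 0.
Proof.
rewrite tE_ratio -(mulr0 (rhoE S c)); have [Rm rm] := mE_ratio S c.
by apply: (pg_mul pgX); [exact: value_rj|exact: value_tE0].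
Qed.

Lemma value_tE_ratio c : value (tE S c / tE S None) (rhoE S c).
Proof.
rewrite tE_ratio mulfK ?tE_neq0 //; have [Rm rm] := mE_ratio S c.
exact: value_rj.
Qed.

Lemma value_AE_exists c x : AE S c x -> exists r, value x r.
Proof.
move=> /AE_sum[a [ha ->]]; apply: (@big_ind _ (fun x => exists r, value x r)).
- by exists 0; rewrite -(rmorph0 (embX S)); exact: (pg_emb pgX).
- by move=> y z [r yr] [s zs]; exists (r + s); exact: (pg_add pgX).
move=> i _; have [r ar _] := RE_res (ha i); exists (r * 0 ^+ i).
apply: (pg_mul pgX); last by apply: (pg_exp pgX); exact: value_tE.
by apply: value_rj => //; exact: RE_sub_generic (ha i).
Qed.

Lemma AE_value c x : AE S c x -> exists a y r, [/\ RE S c a, AE S c y,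
  x = rj S a + tE S c * y, res_inf a r & value x r].
Proof.
move=> /(AE_dec hp)[a [y [Ra Ay e]]]; have [r ar Or] := RE_res Ra.
exists a, y, r; split=> //; have [s ys] := value_AE_exists Ay.
rewrite e -(addr0 r) -(mul0r s); apply: (pg_add pgX).
  by apply: value_rj => //; exact: RE_sub_generic Ra.
by apply: (pg_mul pgX) => //; exact: value_tE.
Qed.

Lemma AE_res c x : AE S c x -> exists2 r, value x r & stalkC c r.
Proof.
move=> /AE_value[a [y [r [Ra _ _ ar xr]]]]; exists r => //.
by have [r' ar' Or] := RE_res Ra; rewrite (pg_fun pg ar ar').
Qed.

Lemma AE_embX c a : stalkC c a -> AE S c (embX S a).
Proof. by move=> Oa; apply: AE_rj; case: (@RE_dom _ _ _ _ S c a). Qed.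

Lemma uE_tE c : rj S (uE S c) = tE S c ^+ rl S * rj S (eE S c)^-1.
Proof.
have [_ _ e0 _] := eE_spec S hp c.
by rewrite (tE_exp S hp) -rmorphM mulfK.
Qed.

(** The constant term then has value 0, so it is a multiple of u = t^l e^-1, hence of t. *)
Lemma AE_ker c x : AE S c x -> value x 0 -> exists2 y, AE S c y & x = tE S c * y.
Proof.
move=> /AE_value[a [y [r [Ra Ay e ar xr]]]] x0.
rewrite (pg_fun pgX xr x0) in ar.
have [a' Ra' ea] := point_inf_ker (vO c) (dE_neq0 S c) Ra ar.
have [_ Rei _ _] := eE_spec S hp c.
exists (tE S c ^+ (rl S).-1 * rj S (eE S c)^-1 * rj S a' + y).
  apply: (subringD (sA c)) => //; apply: (subringM (sA c)); last exact: AE_rj.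
  apply: (subringM (sA c)); last exact: AE_rj.
  by apply: (subringX _ (sA c)); exact: AE_tE.
rewrite e ea rmorphM uE_tE mulrDr !mulrA -exprS prednK ?rl_gt0 //.
Qed.

(* The local ring of X at the point of \tilde E over c. *)
Definition TE c : set (rKX S) := composite value (stalkC c) (AE S c).

Lemma TE_subring c : subring (TE c).
Proof. exact: composite_subring pgX (vO c) (sA c) (@AE_res c). Qed.

Lemma sub_TE c : AE S c `<=` TE c.
Proof. exact: sub_composite pgX (vO c) (sA c) (@AE_res c). Qed.

Lemma TE_tE c : TE c (tE S c).
Proof. by apply: sub_TE; exact: AE_tE. Qed.

Lemma TE_res c x : TE c x -> exists2 r, value x r & stalkC c r.
Proof. exact: composite_res pgX (vO c) (@AE_res c) _. Qed.

Lemma TE_ker c x : TE c x -> value x 0 -> exists2 y, TE c y & x = tE S c * y.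
Proof. exact: (composite_ker pgX (vO c) (@AE_res c) (@AE_ker c)). Qed.

Lemma TE_over c : lies_over (embX S) (TE c) c.
Proof. exact: (composite_dominates pgX (vO c) (sA c) (@AE_res c) (@AE_embX c)). Qed.

Let centerE c := center value (stalkC c) (AE S c).

Lemma centerE_prime c : prime_ideal (AE S c) (centerE c).
Proof. exact: center_prime pgX (vO c) (sA c) (@AE_res c). Qed.

Lemma centerE_rj c a : RE S c a -> (centerE c (rj S a) <-> maxid (RE S c) a).
Proof.
move=> Ra; have [r ar Or] := RE_res Ra.
have er : value (rj S a) r by apply: value_rj => //; exact: RE_sub_generic Ra.
have mr := point_inf_maxid (vO c) (dE_neq0 S c) Ra ar.
split=> [[_ [s /(pg_fun pgX er) <-]]|ma]; first by move/mr.
by split; [exact: AE_rj|exists r => //; exact/mr].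
Qed.

Lemma TE_surface c : surface S (TE c).
Proof.
exists (RE S c), (centerE c); split=> //; first exact: RE_proj.
  exact: centerE_prime.
exact: centerE_rj.
Qed.

(** The ramification leaves no choice: t^l = u e lies in q, so t does, and as A = R + tA the prime q
    is determined by its trace on R. *)
Lemma TE_uniq c q : prime_ideal (AE S c) q ->
  (forall a, RE S c a -> (q (rj S a) <-> maxid (RE S c) a)) ->
  localize (AE S c) q = TE c.
Proof.
move=> qP qc; suff -> : q = centerE c by [].
have [q1 qD qM qpr] : [/\ ~ q 1, forall x y, q x -> q y -> q (x + y),
    forall x y, AE S c x -> q y -> q (x * y) &
    forall x y, AE S c x -> AE S c y -> q (x * y) -> q x \/ q y].
  by case: qP => _ _ ? ? [? ?]; split.
have qt : q (tE S c).
  have [Re _ _ _] := eE_spec S hp c.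
  have : q (tE S c ^+ rl S).
    rewrite (tE_exp S hp) qc; last by apply: (subringM (sR c)) => //; exact: RE_uE.
    apply/(point_inf_maxid (vO c) (dE_neq0 S c) (r := 0)).
    - by apply: (subringM (sR c)) => //; exact: RE_uE.
    - exact: res_uE_mul.
    - exact: maxid0.
  elim: (rl S) => [|n IH]; first by rewrite expr0.
  rewrite exprS => /qpr[]//; first exact: AE_tE.
  by apply: (subringX _ (sA c)); exact: AE_tE.
have qcen x : AE S c x -> (q x <-> centerE c x).
  move=> Ax; have [a [y [r [Ra Ay e ar xr]]]] := AE_value Ax.
  have qty : q (tE S c * y) by rewrite mulrC; exact: qM.
  have -> : q x <-> q (rj S a).
    rewrite e; split=> h; last exact: qD.
    rewrite -[rj S a](addrK (tE S c * y)) -mulN1r; apply: qD => //; apply: qM => //.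
    by apply: (subringN (sA c)); exact: (subring1 (sA c)).
  rewrite (qc _ Ra) (point_inf_maxid (vO c) (dE_neq0 S c) Ra ar).
  split=> [mr|[_ [s /(pg_fun pgX xr) <-]]//].
  by split=> //; exists r.
apply/seteqP; split=> x h; first by apply/qcen => //; exact: prime_subset qP h.
by apply/qcen => //; case: h.
Qed.

Lemma TE_dominates c : dominates (rj S) (TE c) (RE S c).
Proof.
apply: cyclic_dominates => //; [exact: RE_proj|exact: centerE_prime|exact: centerE_rj].
Qed.

(** [Et_ideal] lets R range over the points dominated by T; this makes R unique. If R were off E, it
    would contain 1 / u, which has no value on \tilde E because u has value 0 there. *)
Lemma dominated_RE c R : rP S R -> dominates (rj S) (TE c) R -> R = RE S c.
Proof.
move=> hR dR; have sRR : subring R by exact: projE_subring hR.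
have [c' hc'] := projE_over hR.
have hc : lies_over (embX S) (TE c) c' by exact: dominates_trans dR hc'.
rewrite (lies_over_uniq hc (@TE_over c)) in hc'.
apply: (projE_uniq (dE_neq0 S c) (rE_frame S c) hR hc') => d1.
have Rg : R (lin (dE S c * hE S c, dE S c)).
  rewrite -[lin _]mul1r; apply: d1; rewrite /O1 (pull_genE _ _ hc').
  apply: sub_span; first exact: (subring1 sRR).
  exists (dE S c * hE S c, dE S c) => //; rewrite rE_frame; exact: frame_dh.
have [/TE_res[s gs _] _] := dR _ Rg.
have u0 : value (rj S (uE S c)) 0.
  by apply: value_rj; [apply: RE_sub_generic; exact: RE_uE|exact: res_uE].
have := pg_mul pgX gs u0; rewrite -rmorphM mulfV ?lin_dh_neq0 ?dE_neq0 // rmorph1 mulr0.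
by move=> /(pg_fun pgX (pg1 pgX))/eqP; rewrite oner_eq0.
Qed.

(** If x^n lies in the ideal generated by I_E, its value is 0, so x has value 0 and is a multiple of
    t. Conversely t^l = u e shows that the exponent l puts t in the radical. *)
Lemma Et_ideal_TE c : @Et_ideal _ _ _ _ S (TE c) = prin (TE c) (tE S c).
Proof.
have sT := TE_subring c; apply/seteqP; split.
  move=> x [Tx [n [R [hR dR]]]]; rewrite (dominated_RE hR dR) => hx.
  have [r xr _] := TE_res Tx.
  have : value (x ^+ n) 0.
    move: hx => [m [a [b [hab ->]]]].
    apply: (@big_ind _ (fun x => value x 0)).
    - by rewrite -(rmorph0 (embX S)); exact: (pg_emb pgX).
    - by move=> y z y0 z0; rewrite -(addr0 0); exact: (pg_add pgX).
    move=> i _; have [Ta [y]] := hab i; rewrite rEidealE dual_O1_RE => -[z Rz <-] <-.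
    have [s as_ _] := TE_res Ta; rewrite -(mulr0 s); apply: (pg_mul pgX) => //.
    apply: value_rj; last exact: res_uE_mul.
    by apply: RE_sub_generic; apply: (subringM (sR c)) => //; exact: RE_uE.
  move=> /(pg_fun pgX (pg_exp pgX n xr))/eqP; rewrite expf_eq0 => /andP[_ /eqP r0].
  by rewrite r0 in xr; have [y Ty ->] := TE_ker Tx xr; exists y.
move=> _ [y Ty <-]; split; first by apply: (subringM sT) => //; exact: TE_tE.
exists (rl S), (RE S c); split; [exact: RE_proj|exact: TE_dominates|].
rewrite exprMn (tE_exp S hp); have [Re _ _ _] := eE_spec S hp c.
rewrite mulrC; have [_ _ sM] := span_submodule (rj S @` rEideal S (RE S c)) sT.
apply: sM; first exact: subringX.
apply: sub_span; first exact: (subring1 sT).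
exists (uE S c * eE S c) => //; rewrite rEidealE dual_O1_RE.
by exists (eE S c).
Qed.

Lemma TE_Et c : Et S (TE c).
Proof.
split; first exact: TE_surface.
rewrite Et_ideal_TE => -[y /TE_res[s ys _] e].
have := pg_mul pgX (value_tE c) ys; rewrite e mul0r.
by move=> /(pg_fun pgX (pg1 pgX))/eqP; rewrite oner_eq0.
Qed.

(** If the point R below T were off E, then 1 would lie in the ideal of E at R and so in that of
    \tilde E at T. *)
Lemma Et_TE T : Et S T -> exists c, T = TE c.
Proof.
move=> [[R [q [hR qP qc eT]]] h1].
have dR : dominates (rj S) T R by rewrite eT; exact: cyclic_dominates.
have sT : subring T by rewrite eT; apply: localize_subring => //; exact: cyclic_subring.
have [c hc] := projE_over hR; exists c.
have eR : R = RE S c.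
  apply: (projE_uniq (dE_neq0 S c) (rE_frame S c) hR hc) => d1; apply: h1.
  split; first exact: (subring1 sT).
  exists 1%N, R; split=> //; apply: sub_span; first exact: (subring1 sT).
  by exists 1; rewrite ?rEidealE // rmorph1.
by rewrite eT; move: qP qc; rewrite eR => qP qc; exact: TE_uniq.
Qed.

Lemma Et_ideal_full T : surface S T -> @Et_ideal _ _ _ _ S T 1 ->
  @Et_ideal _ _ _ _ S T = T.
Proof.
move=> hT; have sT := surface_subring hp hT; move=> [_ [n [R [hR dR]]]].
rewrite expr1n => h1; apply/seteqP; split=> [x []//|x Tx].
split=> //; exists 1%N, R; split=> //; rewrite expr1 -[x]mulr1.
by have [_ _ sM] := span_submodule (rj S @` rEideal S R) sT; exact: sM.
Qed.

(** Off \tilde E the generator is 1, on it some [tE c]; so \tilde E is a Cartier divisor on the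
    whole surface. *)
Lemma Et_ideal_prin T : surface S T -> exists2 y, y != 0 &
  @Et_ideal _ _ _ _ S T = prin T y.
Proof.
move=> hT; have [h1|h1] := pselect (@Et_ideal _ _ _ _ S T 1).
  by exists 1; rewrite ?oner_neq0 // prin1; exact: Et_ideal_full.
have [|c ->] := @Et_TE T; first by split.
by exists (tE S c); [exact: tE_neq0|exact: Et_ideal_TE].
Qed.

End SectionE.

Arguments TE {k K iota p} S c _.

(** * The normal sheaf *)

Section CartierPrincipal.
Local Open Scope classical_set_scope.
Local Open Scope ring_scope.
Variable F : fieldType.

Lemma Cartier_sheaf_prin (A : set F -> set F) (T : set F) y : subring T ->
  y != 0 -> A T y -> (forall y', A T y' -> exists2 a, T a & y = a * y') ->
  Cartier_sheaf A T = prin T y^-1.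
Proof.
move=> sT y0 Ay h; apply/seteqP; split=> x.
  move=> [y' /h[a Ta e] Txy]; apply/prinE; first by rewrite invr_eq0.
  by rewrite invrK e mulrCA; exact: subringM.
by move=> /prinE; rewrite invr_eq0 invrK => /(_ y0) Txy; exists y.
Qed.

Lemma prin_mulE (T : set F) y : [set x * y | x in T] = prin T y.
Proof. by apply/seteqP; split=> _ [x Tx <-]; exists x => //; rewrite mulrC. Qed.

Lemma prin_scale (T : set F) g x : prin T (g * x) = [set g * z | z in prin T x].
Proof.
apply/seteqP; split=> [_ [y Ty <-]|_ [_ [y Ty <-] <-]].
  by exists (x * y); [exists y|rewrite mulrA].
by exists y; rewrite ?mulrA.
Qed.

End CartierPrincipal.

Section Normal.
Local Open Scope classical_set_scope.
Local Open Scope ring_scope.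
Context {k : closedFieldType} {K : fieldType} {iota : {rmorphism k -> K}} {p : nat}.
Variable S : raynaud iota p.
Hypothesis hp : p \in [pchar K].
Hypothesis hK : function_field_of_curve iota.
Implicit Types (c : point iota) (T : set (rKX S)).

Let vO c := @stalkC_valuation _ _ iota c.
Let pgX := value_graph S hp.
Let sT c := @TE_subring _ _ _ _ S hp c.
Let value := @value _ _ _ _ S.

Lemma Et_ideal_gen T y : subring T -> y != 0 -> @Et_ideal _ _ _ _ S T = prin T y ->
  forall y', Cartier_of_ideal (@Et_ideal _ _ _ _ S) T y' -> exists2 a, T a & y = a * y'.
Proof.
move=> sT' y0 e y' [_]; rewrite e => h.
have : prin T y y by exists 1; [exact: (subring1 sT')|rewrite mulr1].
by rewrite h => -[a Ta ea]; exists a.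
Qed.

Lemma OX_Et_prin T y : subring T -> y != 0 -> @Et_ideal _ _ _ _ S T = prin T y ->
  OX_Et S T = prin T y^-1.
Proof.
move=> sT' y0 e; apply: Cartier_sheaf_prin => //; last exact: Et_ideal_gen.
by split=> //; rewrite prin_mulE.
Qed.

Lemma OX_Dt_prin T y c (D' : place iota -> int) d : subring T -> y != 0 ->
  @Et_ideal _ _ _ _ S T = prin T y -> lies_over (embX S) T c -> d != 0 ->
  (forall v, c = Some v -> ord v d = D' v) ->
  OX_Dt S D' T = prin T (y * embX S d)^-1.
Proof.
move=> sT' y0 e hc d0 hd; apply: Cartier_sheaf_prin => //.
- by rewrite mulf_neq0 ?fmorph_eq0.
- exists y, (embX S d); split=> //; first by split=> //; rewrite prin_mulE.
  by exists c, d.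
move=> _ [y' [_ [/(Et_ideal_gen sT' y0 e)[a Ta ->] [c' [d' [hc' d'0 hd' ->]]] ->]]].
rewrite (lies_over_uniq hc' hc) in hd'.
exists (a * embX S (d / d')); last first.
  by rewrite mulrACA -rmorphM divfK.
apply: (subringM sT') => //; case: (hc (d / d')) => //.
case: c hd hd' {hc hc'} => [v|//] hd hd' /=; right.
by rewrite ordM ?invr_eq0 // ordV hd // hd' // subrr oppr0.
Qed.

Lemma OX_Et_TE c : OX_Et S (TE S c) = prin (TE S c) (tE S c)^-1.
Proof. exact: OX_Et_prin (sT c) (tE_neq0 S c) (Et_ideal_TE S hp c). Qed.

Lemma TE_inv_generic x r : TE S None x -> value x r -> r != 0 -> TE S None x^-1.
Proof.
by move=> Tx xr r0; exact: (composite_inv pgX (vO None) (@AE_res _ _ _ _ S hp None) Tx xr).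
Qed.

Lemma TE_embX c a : stalkC c a -> TE S c (embX S a).
Proof. by move=> Oa; case: (@TE_over _ _ _ _ S hp c a Oa). Qed.

Lemma TE_tE_ratio c : TE S None (tE S c / tE S None).
Proof.
rewrite tE_ratio mulfK ?tE_neq0 //; have [Rm rm] := mE_ratio S c.
by apply: sub_TE => //; exact: AE_rj.
Qed.

Lemma TE_sub_generic c : TE S c `<=` TE S None.
Proof.
have t_c : TE S None (tE S c).
  rewrite -(divfK (tE_neq0 S None) (tE S c)); apply: (subringM (sT None)).
    exact: TE_tE_ratio.
  exact: TE_tE.
have sub : AE S c `<=` TE S None.
  move=> _ /AE_sum[a [ha ->]]; apply: (@subring_sum _ (TE S None) _ _ _ _ (sT None)) => i _.
  apply: (subringM (sT None)); last by apply: (subringX _ (sT None)).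
  by apply: sub_TE => //; apply: AE_rj; exact: RE_sub_generic (ha i).
move=> _ [a [b [Aa Ab cb ->]]].
have [r [br r0 _ _]] := not_center (vO c) (@AE_res _ _ _ _ S hp c) Ab cb.
apply: (subringM (sT None)); first exact: sub.
by apply: TE_inv_generic br r0; exact: sub.
Qed.

Lemma generic_point_Et : generic_point (Et S) (TE S None).
Proof.
split; first exact: TE_Et.
by move=> T /(Et_TE hp)[c ->]; exact: TE_sub_generic.
Qed.

(** Hence the generic stalk V is t^-1 T / T with T = [TE S None], and taking the value of t x
    identifies it with K. *)
Lemma tensor_generic : tensor (@Et_ideal _ _ _ _ S) (OX_Et S) (TE S None) = TE S None.
Proof.
rewrite (tensor_prin (sT None) (Et_ideal_TE S hp None) (OX_Et_TE None)).
by rewrite mulfV ?tE_neq0 // prin1.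
Qed.

Lemma value_diff x y r s : value x r -> value y s -> TE S None x -> TE S None y ->
  r = s -> exists2 z, TE S None z & x - y = tE S None * z.
Proof.
move=> xr ys Tx Ty e; apply: TE_ker => //; first exact: (subringB (sT None)).
by rewrite -(subrr s) -{1}e; exact: (pg_sub pgX).
Qed.

Lemma normal_frame_ex : normal_frame S (TE S None) (tE S None)^-1.
Proof.
rewrite /normal_frame tensor_generic OX_Et_TE; have t0 := tE_neq0 S None; split.
  by exists 1; rewrite ?mulr1 //; exact: (subring1 (sT None)).
move=> _ [y Ty <-]; have [r yr _] := TE_res hp Ty; exists r; split.
  have [z Tz e] := value_diff yr (pg_emb pgX r) Ty (@TE_embX None r I) erefl.
  by rewrite [embX S r * _]mulrC -mulrBr e mulKf.
move=> a; rewrite [embX S a * _]mulrC -mulrBr => hz.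
have [s zs _] := TE_res hp hz.
have := pg_mul pgX (value_tE S hp None) zs; rewrite mulVKf // mul0r => h.
apply/eqP; rewrite -subr_eq0; apply/eqP.
exact: (pg_fun pgX (pg_sub pgX yr (pg_emb pgX a)) h).
Qed.

Lemma normal_frame_value v : normal_frame S (TE S None) v ->
  exists y r, [/\ TE S None y, value y r, r != 0 & v = (tE S None)^-1 * y].
Proof.
rewrite /normal_frame tensor_generic OX_Et_TE => -[[y Ty <-] h].
have [r yr _] := TE_res hp Ty; exists y, r; split=> //; apply/eqP => r0.
have t0 := tE_neq0 S None; rewrite r0 in yr.
have [z Tz e] := TE_ker hp Ty yr.
(* If r = 0, then v vanishes in V, so both 0 and 1 are coordinates of v, against uniqueness. *)
have [|a [_ ha]] := h ((tE S None)^-1 * y); first by exists y.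
have h1 : TE S None ((tE S None)^-1 * y) by rewrite e mulKf.
have e0 : a = 0 by apply: ha; rewrite rmorph0 mul0r subr0.
have e1 : a = 1 by apply: ha; rewrite rmorph1 mul1r subrr; exact: (subring0 (sT None)).
by move/eqP: e1; rewrite e0 eq_sym oner_eq0.
Qed.

(** Write the element as Y / t_c, where Y has value rho a r. Modulo the generic stalk of functions
    only this value matters, and a value in O_c is attained by a constant of [TE S c]. *)
Lemma restriction_TE c a y r : TE S None y -> value y r ->
  restriction (OX_Et S) (@Et_ideal _ _ _ _ S) (TE S None) (TE S c)
    (embX S a * ((tE S None)^-1 * y)) <-> stalkC c (rhoE S c * a * r).
Proof.
move=> Ty yr; have tc0 := tE_neq0 S c.
set Y := tE S c / tE S None * embX S a * y.
have TY : TE S None Y.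
  apply: (subringM (sT None)) => //; apply: (subringM (sT None)).
    exact: TE_tE_ratio.
  exact: TE_embX.
have Yr : value Y (rhoE S c * a * r).
  apply: (pg_mul pgX) => //; apply: (pg_mul pgX); last exact: (pg_emb pgX).
  exact: value_tE_ratio.
have -> : embX S a * ((tE S None)^-1 * y) = (tE S c)^-1 * Y.
  rewrite /Y; move: (tE S c) (tE S None) (embX S a) tc0 => t t' b tc0.
  by rewrite !mulrA mulVf // mul1r [_^-1 * b]mulrC.
rewrite /restriction tensor_generic OX_Et_TE; split.
  move=> [_ [z [[X TX <-] Tz]]] /(congr1 (fun x => tE S c * x)).
  rewrite mulVKf // mulrDr mulVKf // => e; move: Yr; rewrite e => Yr.
  have [s Xs Os] := TE_res hp TX; have [s' zs' _] := TE_res hp Tz.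
  rewrite (pg_fun pgX Yr (pg_add pgX Xs (pg_mul pgX (value_tE S hp c) zs'))).
  by rewrite mul0r addr0.
move=> Ob; set b := rhoE S c * a * r in Yr Ob *.
have [z Tz e] := value_diff Yr (pg_emb pgX b) TY (@TE_embX None b I) erefl.
exists ((tE S c)^-1 * embX S b), ((tE S c / tE S None)^-1 * z); split.
- by exists (embX S b) => //; exact: TE_embX.
- apply: (subringM (sT None)) => //.
  apply: TE_inv_generic (rhoE_neq0 S c); first exact: TE_tE_ratio.
  exact: value_tE_ratio.
- by rewrite invf_div [tE S None / _]mulrC -[_ * tE S None * z]mulrA -e -mulrDr addrC subrK.
Qed.

(* N_l ~ (p+1)/l D - p N_l, since D ~ l N_l. *)
Lemma normal_sheafE v : normal_frame S (TE S None) v -> exists2 g, g != 0 &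
  forall c, @normal_sheaf _ _ _ _ S (TE S None) v c = prin (stalkC c) (g * nE S c).
Proof.
move=> /normal_frame_value[y [r [Ty yr r0 ->]]].
have [ga ga0 gaE] := rN_root S.
(* The factors of rho r that do not vary with c: the generic generators, the value r of the frame,
   and [ga]^q from D = e N + div(ga). *)
pose de := dE S None ^+ qE S / nE S None ^+ p * ga ^+ qE S * r.
have de0 : de != 0.
  by rewrite !mulf_neq0 ?invr_eq0 ?expf_neq0 ?dE_neq0 ?nE_neq0.
have ordE w : ord w (rhoE S (Some w) * r) = rNl S w + ord w de.
  have [d0 d0'] := (dE_neq0 S None, dE_neq0 S (Some w)).
  have [n0 n0'] := (nE_neq0 S None, nE_neq0 S (Some w)).
  rewrite /rhoE /de !(ordM, ordX, ordV, mulf_neq0, expf_neq0, invr_neq0) //.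
  rewrite !ord_div_gen gaE /rNl /mul_div.
  (* With D replaced by l N_l + div(ga), the varying part of the order is (q l - p) N_l, and q l = p
     + 1. *)
  have eQ : (qE S)%:Z * (rl S)%:Z = p%:Z + 1.
    by rewrite -PoszM divnK ?rl_dvdp // -addn1 PoszD.
  have eR : (re S)%:Z = (re S %/ rl S)%:Z * (rl S)%:Z.
    by rewrite -PoszM divnK ?rl_dvde.
  rewrite eR; move: eQ; move: (qE S)%:Z (rl S)%:Z (re S %/ rl S)%:Z p%:Z => Q l E P eQ.
  have -> : P = Q * l - 1 by rewrite eQ addrK.
  ring.
have stalkE c a : stalkC c (rhoE S c * a * r) <-> OC (rNl S) c (de * a).
  case: c => [w|//]; have [->|a0] := eqVneq a 0.
    by rewrite mulr0 mul0r mulr0; split=> _; left.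
  have ra0 : rhoE S (Some w) * a * r != 0.
    exact: (mulf_neq0 (mulf_neq0 (rhoE_neq0 S _) a0) r0).
  have da0 : de * a != 0 by rewrite mulf_neq0.
  have e : ord w (rhoE S (Some w) * a * r) = rNl S w + ord w (de * a).
    have rr0 := mulf_neq0 (rhoE_neq0 S (Some w)) r0.
    by rewrite mulrAC (ordM _ rr0 a0) ordE (ordM _ de0 a0) addrA.
  rewrite /= oppr0; split=> /ord_geE.
    by move=> /(_ ra0); rewrite e => h; right; lia.
  by move=> /(_ da0) h; right; rewrite e; lia.
have OCE c a : OC (rNl S) c (de * a) <-> prin (stalkC c) (de^-1 * nE S c) a.
  rewrite OC_gen; have nc0 := div_gen_neq0 (rNl S) c.
  split=> [[x Ox e]|[x Ox <-]].
    by exists x => //; rewrite -mulrA e mulKf.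
  by exists x => //; rewrite -[_ * nE S c * x]mulrA mulVKf.
exists de^-1; first by rewrite invr_eq0.
move=> c; apply/seteqP; split=> a.
  move=> [P [_ cP hP]]; apply/OCE/stalkE/(restriction_TE c a Ty yr).
  by apply: (hP _ c) => //; [exact: TE_Et|exact: TE_over].
move=> /OCE ha; have [a0|a0] := eqVneq a 0.
  exists set0; split=> [||T c' /(Et_TE hp)[c'' ->] _ _]; [exact: finite_set0|by move=> w _ []|].
  by apply/(restriction_TE c'' a Ty yr)/stalkE; rewrite a0 mulr0; case: (c'') => // w; left.
(* The places removed lie among the zeros and poles of [de * a] and the support of N; c itself is
   kept by [ha]. *)
exists [set w | ~ OC (rNl S) (Some w) (de * a)]; split.
- apply: (@sub_finite_set _ _ ([set w | ord w (de * a) != 0] `|` [set w | rN S w != 0])).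
    move=> w /= h; apply: contrapT => /not_orP[/negP/negPn/eqP ow /negP/negPn/eqP nw].
    by apply: h; right; rewrite ow /rNl /mul_div nw mulr0 oppr0.
  rewrite finite_setU; split; last exact: rN_div.
  exact: function_field_finite_ord.
- by move=> w e; rewrite e in ha => h; exact: h.
move=> T c' /(Et_TE hp)[c'' ->] hc' h.
rewrite (lies_over_uniq hc' (@TE_over _ _ _ _ S hp c'')) in h.
apply/(restriction_TE c'' a Ty yr)/stalkE.
by case: c'' h {hc'} => [w|//] h; apply: contrapT; exact: h.
Qed.

Lemma sheaf_iso_Z v (D' : place iota -> int) : normal_frame S (TE S None) v ->
  lin_equiv D' (rNl S) ->
  sheaf_iso (surface S) (sheafZ S (TE S None) v)
    (tensor (OX_Et S) (pullC (embX S) (OC (rNl S)))) /\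
  sheaf_iso (surface S) (sheafZ S (TE S None) v) (OX_Dt S D').
Proof.
move=> /normal_sheafE[g g0 hg] [ga ga0 gaE].
have local T : surface S T -> exists y c, [/\ y != 0, subring T,
    @Et_ideal _ _ _ _ S T = prin T y, lies_over (embX S) T c &
    sheafZ S (TE S None) v T = prin T (y^-1 * embX S (g * nE S c))].
  move=> hT; have [y y0 e] := Et_ideal_prin hp hT.
  have sT' := surface_subring hp hT; have [c hc] := surface_over hp hT.
  exists y, c; split=> //; apply: tensor_prin => //; first exact: OX_Et_prin.
  exact: pullC_prin hc (hg c).
split.
  exists (embX S g^-1); first by rewrite fmorph_eq0 invr_eq0.
  move=> T /local[y [c [y0 sT' e hc ->]]]; rewrite -prin_scale.
  have -> : embX S g^-1 * (y^-1 * embX S (g * nE S c)) = y^-1 * embX S (nE S c).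
    by rewrite mulrCA -rmorphM mulKf.
  apply: tensor_prin => //; first exact: OX_Et_prin.
  exact: pullC_prin hc (OC_gen _ _).
(* As D' = N_l + div(ga) and n has order - N_l, the quotient ga / n is a local equation of D'; its
   inverse n / ga differs from g n by one factor for all points. *)
exists (embX S (g^-1 / ga)); first by rewrite fmorph_eq0 mulf_neq0 ?invr_eq0.
move=> T /local[y [c [y0 sT' e hc ->]]]; rewrite -prin_scale.
have n0 := nE_neq0 S c.
rewrite (OX_Dt_prin (d := ga / nE S c) sT' y0 e hc).
- congr (prin T _); rewrite mulrCA -rmorphM invfM -fmorphV; congr (_ * embX S _).
  by rewrite invf_div mulrAC mulKf.
- by rewrite mulf_neq0 ?invr_eq0.
- by move=> w ->; rewrite ordM ?invr_eq0 ?nE_neq0 // ordV ord_div_gen gaE opprK addrC.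
Qed.

End Normal.

Theorem proposition16 (k : closedFieldType) (K : fieldType)
    (iota : {rmorphism k -> K}) (p : nat) (hp : p \in [pchar k]%R)
    (hK : function_field_of_curve iota)
    (g : nat) (hg : has_genus iota g) (hg2 : (2 <= g)%N)
    (S : raynaud iota p)
    (D' : place iota -> int) (hD' : is_divisor D')
    (hND' : lin_equiv D' (rNl S)) :
  exists eta : set (rKX S),
    [/\ generic_point (Et S) eta,
        exists v, normal_frame S eta v &
        forall v, normal_frame S eta v ->
          sheaf_iso (surface S) (sheafZ S eta v)
            (tensor (OX_Et S) (pullC (embX S) (OC (rNl S))))
          /\
          sheaf_iso (surface S) (sheafZ S eta v) (OX_Dt S D')].
Proof.
have hpK : (p \in [pchar K])%R by rewrite (fmorph_pchar iota).
(* The generic point of the section \tilde E is its point over the generic point of C. *)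
exists (TE S None); split; first exact: generic_point_Et.
  by exists (tE S None)^-1%R; exact: normal_frame_ex.
by move=> v hv; exact: sheaf_iso_Z.
Qed.
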